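(* For real $\beta_1,\beta_2$ and each $n$, let $G_n$ be the exponential random graph on $n$ vertices with edges and triangles as sufficient statistics, i.e. a random simple graph on $\{1,\dots,n\}$ with $$\mathbb{P}(G_n=G)=e^{n^2(T(G)-\psi_n)},\qquad T(G)=2\beta_1\frac{\#\text{edges in }G}{n^2}+6\beta_2\frac{\#\text{triangles in }G}{n^3},$$ where $\psi_n$ is the normalizing constant. Fix any $\beta_1<0$ and let $$c_1:=\frac{e^{\beta_1}}{1+e^{\beta_1}},\qquad c_2:=1+\frac{1}{2\beta_1}.$$ Suppose $|\beta_1|$ is so large that $c_1<c_2$. Let $e(G_n)$ be the number of edges in $G_n$ and let $f(G_n):=e(G_n)/\binom n2$ be the edge density. Then there exists $q=q(\beta_1)\in[0,\infty)$ such that if $-\infty<\beta_2<q$, then $$\lim_{n\to\infty}\mathbb{P}\bigl(f(G_n)>c_1\bigr)=0,$$ and if $\beta_2>q$, then $$\lim_{n\to\infty}\mathbb{P}\bigl(f(G_n)<c_2\bigr)=0.$$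
   Context: Simple graphs are undirected without loops or multiple edges. The normalizing constant $\psi_n=\psi_n(\beta_1,\beta_2)$ is the unique real number making the given probabilities sum to $1$ over all simple graphs $G$ on the vertex set $\{1,\dots,n\}$, i.e. $\psi_n=\frac1{n^2}\log\sum_Ge^{n^2T(G)}$. *)

(* Defs.v *)
From HB Require Import structures.
From mathcomp Require Import all_boot all_order all_algebra.
From mathcomp Require Import all_classical all_reals all_analysis.

Set Implicit Arguments.
Unset Strict Implicit.
Unset Printing Implicit Defensive.

Import Order.TTheory GRing.Theory Num.Theory.
Import numFieldNormedType.Exports.

Local Open Scope ring_scope.

(* The vertex set {1, ..., n} is 'I_n; a simple graph is its set of edges,
   an edge being an unordered pair of distinct vertices. *)
Definition simple_graph (n : nat) : finType :=
  {E : {set {set 'I_n}} | [forall e in E, #|e| == 2%N]}.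

Definition edges n (G : simple_graph n) : {set {set 'I_n}} := val G.

Definition triangles n (G : simple_graph n) : {set {set 'I_n}} :=
  [set A : {set 'I_n} | (#|A| == 3%N) &&
     [forall e : {set 'I_n}, (#|e| == 2%N) && (e \subset A) ==> (e \in edges G)]].

Section ERGM.
Variables (R : realType) (beta1 beta2 : R) (n : nat).
Implicit Types G : simple_graph n.

Definition ergm_stat G : R :=
  2 * beta1 * (#|edges G|%:R / n%:R ^+ 2) +
  6 * beta2 * (#|triangles G|%:R / n%:R ^+ 3).

Definition ergm_psi : R :=
  (n%:R ^+ 2)^-1 * ln (\sum_(G : simple_graph n) expR (n%:R ^+ 2 * ergm_stat G)).

Definition ergm_pmf G : R := expR (n%:R ^+ 2 * (ergm_stat G - ergm_psi)).

Definition ergm_prob (A : pred (simple_graph n)) : R := \sum_(G | A G) ergm_pmf G.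

End ERGM.

Definition edge_density (R : realType) n (G : simple_graph n) : R :=
  #|edges G|%:R / 'C(n, 2)%:R.

Definition c1 (R : realType) (beta1 : R) : R := expR beta1 / (1 + expR beta1).

Definition c2 (R : realType) (beta1 : R) : R := 1 + (2 * beta1)^-1.

Lemma ergm_pmf_sum1 (R : realType) (beta1 beta2 : R) n : (0 < n)%N ->
  \sum_(G : simple_graph n) ergm_pmf beta1 beta2 G = 1.
Proof.
move=> n_gt0.
have n2 : n%:R ^+ 2 != 0 :> R by rewrite expf_neq0 // pnatr_eq0 -lt0n.
set S := \sum_(G : simple_graph n) expR (n%:R ^+ 2 * ergm_stat beta1 beta2 G).
have H0 : [forall e in (finset.set0 : {set {set 'I_n}}), #|e| == 2%N].
  by apply/forall_inP => e; rewrite finset.in_set0.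
have S_gt0 : 0 < S.
  rewrite /S (bigD1 (Sub finset.set0 H0 : simple_graph n)) //=.
  by rewrite ltr_pwDl ?expR_gt0 // sumr_ge0 // => G _; rewrite expR_ge0.
rewrite (eq_bigr (fun G => expR (n%:R ^+ 2 * ergm_stat beta1 beta2 G) / S)).
  by rewrite -mulr_suml divff // gt_eqF.
move=> G _; rewrite /ergm_pmf mulrBr /ergm_psi mulrA divff // mul1r expRB.
by rewrite lnK // posrE.
Qed.

(* Main.v *)
Require Import Defs.
From HB Require Import structures.
From mathcomp Require Import all_boot all_order all_algebra.
From mathcomp Require Import all_classical all_reals all_analysis.
From mathcomp Require Import ring lra zify.

Set Implicit Arguments.
Unset Strict Implicit.
Unset Printing Implicit Defensive.

Import Order.TTheory GRing.Theory Num.Theory.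
Import numFieldNormedType.Exports.

(** The model has a mean-field variational problem: for [b >= 0] the
    normalizing sum [Z] satisfies [n^-2 ln Z -> max L], the maximum being
    over [0 <= u <= 1], where [L u = a u + b u^3 + h(u) / 2] is [free_energy
    a b u], [h] is the binary entropy, [a = beta1] and [b = beta2]. The edge
    density concentrates where [L] is maximal, so the theorem reduces to
    calculus for [L] plus a soft large-deviation argument.

    Calculus. A maximizer [u] of [L] solves [u = logistic (2 a + 6 b u^2)]
    and satisfies [12 b u^2 (1 - u) <= 1]. If [u <= c2], that is [-2 a (1 -
    u) >= 1], the second condition gives [6 b u^2 <= -a], and then the first
    one gives [u <= logistic a = c1]; so, with some care for strictness, no
    maximizer [u] has [c1 <= u <= c2] ([maximizer_dichotomy]). Maximizers
    increase with [b], so there is a threshold [q] such that for [0 <= b <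
    q] all of them are less than [c1] and for [b > q] all of them exceed
    [c2] ([threshold_exists]).

    Upper bound on [Z] ([partition_function_le]). By weak regularity every
    graph has a partition of its vertices into boundedly many parts such
    that replacing the adjacency matrix [A] by its block averages [B]
    changes the triangle count by [o(n^3)]. The inequality [3 x y z <= x^3 +
    y^3 + z^3] bounds the triangle count of [B] by [n (sum B^3)], and the
    random graph with independent edges of probabilities [B] gives the graph
    itself mass at least [exp (- (sum h(B)) / 2)]. So the weight of the
    graph is at most [exp (sum L(B))], hence [exp (n^2 max L)], times a
    probability, up to [exp (o(n^2))]. Only [exp (o(n^2))] many pairs of a
    partition and a table of block counts occur, and the bound is summed
    over them.

    Lower bound on [Z] ([partition_function_ge]). Jensen's inequality under
    the Erdos-Renyi measure of parameter [u].

    Concentration ([ergm_prob_tilted_cvg0]). Adding [eta] to [a] weights a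
    graph by [exp (2 eta #edges)] and adds [eta u] to [L u]. When all
    maximizers of [L] lie strictly on one side of a level [c], a small tilt
    does not move the maximum across [c], and the bounds on both partition
    functions make the event that the density is on the other side of [c]
    exponentially unlikely.

    Negative [b] ([ergm_prob_repulsive_cvg0]). The cubic inequality now
    points the wrong way, but deleting an edge multiplies the weight by at
    least [exp (- 2 a)], so the number of edges has no larger exponential
    moments than a binomial variable of parameter [logistic (2 a) < c1], and
    Chernoff's bound applies. *)

Local Open Scope ring_scope.

(** * The scalar variational problem *)

Section variational_problem.
Local Open Scope classical_set_scope.
Local Open Scope ring_scope.
Variable R : realType.
Implicit Types u v t a b : R.

Definition entropy u : R := - (u * ln u + (1 - u) * ln (1 - u)).

Definition free_energy a b u : R := a * u + b * u ^+ 3 + entropy u / 2.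

Definition logistic t : R := expR t / (1 + expR t).

(** Tangent-line inequality for [ln]; summed over the two outcomes of a coin it
    is the positivity of relative entropy. *)
Lemma xlnx_tangent u v : 0 <= u -> 0 < v -> u != v ->
  u * (ln v - ln u) < v - u.
Proof.
rewrite le_eqVlt => /predU1P[<- v0 _|u0 v0 uv]; first by rewrite mul0r subr0.
rewrite -ln_div ?posrE//.
have h : ln (v / u) < v / u - 1.
  rewrite -ltr_expR lnK ?posrE ?divr_gt0//.
  have /expR_gt1Dx : v / u - 1 != 0.
    by rewrite subr_eq0; apply: contra uv => /eqP h; rewrite -(divfK (lt0r_neq0 u0) v) h mul1r.
  by rewrite addrC subrK.
have : u * ln (v / u) < u * (v / u - 1) by rewrite ltr_pM2l.
by rewrite mulrBr mulr1 mulrCA divff ?mulr1// gt_eqF.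
Qed.

Lemma entropy_lt_cross u v : 0 <= u <= 1 -> 0 < v < 1 -> u != v ->
  entropy u < - (u * ln v + (1 - u) * ln (1 - v)).
Proof.
move=> /andP[u0 u1] /andP[v0 v1] uv; rewrite /entropy.
have := xlnx_tangent u0 v0 uv.
have : 1 - u != 1 - v by apply: contra uv => /eqP h; apply/eqP; lra.
have u1' : 0 <= 1 - u by lra.
have v1' : 0 < 1 - v by lra.
move=> /(xlnx_tangent u1' v1'); lra.
Qed.

Lemma logistic_itv t : 0 < logistic t < 1.
Proof.
have := expR_gt0 t => e0; rewrite /logistic divr_gt0 ?ltr_pdivrMr//=; lra.
Qed.

Lemma logistic_compl t : 1 - logistic t = (1 + expR t)^-1.
Proof.
have := expR_gt0 t => e0; rewrite /logistic; field.
by rewrite gt_eqF//; lra.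
Qed.

Lemma ln_logistic t : ln (logistic t) = t + ln (1 - logistic t).
Proof.
have e0 := expR_gt0 t.
have e1 : 0 < 1 + expR t by lra.
by rewrite logistic_compl /logistic lnM ?posrE ?invr_gt0// expRK.
Qed.

Lemma logistic_homo s t : s < t -> logistic s < logistic t.
Proof.
rewrite -ltr_expR => st.
have : 1 - logistic t < 1 - logistic s; last by lra.
have := expR_gt0 s => e0.
by rewrite !logistic_compl ltf_pV2 ?posrE//; lra.
Qed.

(** One step of the fixed-point iteration increases the functional.  With
    [v = logistic (2 a + 6 b u^2)], positivity of the entropy of [u] relative to
    [v] bounds the gain below by [b (v^3 - u^3 - 3 u^2 (v - u))], which is
    [b (v - u)^2 (v + 2 u) >= 0].  Maximizers are therefore interior and satisfy
    the stationarity equation, without any analysis at the endpoints. *)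
Lemma free_energy_logistic_gt a b u : 0 <= b -> 0 <= u <= 1 ->
  u != logistic (2 * a + 6 * b * u ^+ 2) ->
  free_energy a b u < free_energy a b (logistic (2 * a + 6 * b * u ^+ 2)).
Proof.
move=> b0 u01 uv; have := entropy_lt_cross u01 (logistic_itv _) uv.
have := ln_logistic (2 * a + 6 * b * u ^+ 2).
have := logistic_itv (2 * a + 6 * b * u ^+ 2).
move: (logistic _) => v /andP[v0 v1] lnv.
rewrite lnv /free_energy; move: (entropy u) => Hu h.
have -> : entropy v = - (v * (2 * a + 6 * b * u ^+ 2) + ln (1 - v)).
  by rewrite /entropy lnv; ring.
move: (ln (1 - v)) h => L h.
have : 0 <= b * ((v - u) ^+ 2 * (v + 2 * u)).
  by case/andP: u01 => u0 u1; apply: mulr_ge0 => //; apply: mulr_ge0; [exact: sqr_ge0|lra].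
move=> h2.
lra.
Qed.

(** At [0] this follows from [|x ln x| <= 2 sqrt x] for small [x]; the value of
    [ln] at nonpositive reals is [0], so continuity holds on the whole line. *)
Lemma xlnx_continuous : continuous (fun x : R => x * ln x).
Proof.
move=> x; have [x0|x0|->] := ltgtP x 0.
- rewrite /continuous_at (ln0 (ltW x0)) mulr0.
  apply: cvg_near_cst; near=> y.
  have : y < 0 by near: y; exact: lt_nbhsl.
  by move=> y0; rewrite ln0 ?mulr0// ltW.
- by apply: continuousM; [exact: cvg_id|exact: continuous_ln].
rewrite /continuous_at mul0r.
have sq : (fun y : R => 2 * Num.sqrt `|y|) @ (0 : R) --> (0 : R).
  have := @cvgM _ _ _ _ (fun=> 2) (fun y : R => Num.sqrt `|y|) 2 (Num.sqrt `|0 : R|)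
    (cvg_cst _) _.
  rewrite normr0 sqrtr0 mulr0; apply.
  rewrite -[X in _ --> X](@sqrtr0 R) -[X in _ --> Num.sqrt X](@normr0 _ R).
  apply: (@continuous_comp _ _ _ (fun y : R => `|y|) (@Num.sqrt R)).
    exact: norm_continuous.
  exact: sqrt_continuous.
apply: (@squeeze_cvgr _ _ _ _ (fun y : R => - (2 * Num.sqrt `|y|))) (sq); last first.
  by rewrite -[X in _ --> X]oppr0; exact: cvgN.
near=> y; apply/andP; split; last first.
  have y1 : y < 1 by near: y; exact: lt_nbhsl.
  have [y0|y0] := leP y 0.
    by rewrite ln0// mulr0 mulr_ge0 ?sqrtr_ge0.
  apply: (@le_trans _ _ 0); last by rewrite mulr_ge0 ?sqrtr_ge0.
  by rewrite pmulr_rle0// ltW// ln_lt0// y0.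
have [y0|y0] := leP y 0.
  by rewrite ln0// mulr0 oppr_le0 mulr_ge0 ?sqrtr_ge0.
rewrite gtr0_norm//; set s := Num.sqrt y.
have s0 : 0 < s by rewrite sqrtr_gt0.
have -> : y = s ^+ 2 by rewrite sqr_sqrtr// ltW.
rewrite lnXn// mulr2n.
have : ln (s^-1) < s^-1 by rewrite ln_sublinear// invr_gt0.
rewrite lnV ?posrE// => h.
have : - ln s * s ^+ 2 < s^-1 * s ^+ 2 by rewrite ltr_pM2r// exprn_gt0.
have -> : s^-1 * s ^+ 2 = s by field; rewrite gt_eqF.
move: (ln s) => L; clear -s0.
lra.
Unshelve. all: by end_near. Qed.

Lemma free_energy_continuous a b : continuous (free_energy a b).
Proof.
move=> x; rewrite /free_energy /entropy.
have cid : {for x, continuous (fun y : R => y)} by exact: cvg_id.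
apply: cvgD; last first.
  apply: cvgM; last exact: cvg_cst.
  apply: cvgN; apply: cvgD; first exact: xlnx_continuous.
  apply: (@continuous_comp _ _ _ (fun y : R => 1 - y) (fun y => y * ln y)).
  2: exact: xlnx_continuous.
  by apply: cvgB => //; exact: cvg_cst.
apply: cvgD; apply: cvgM => //; try exact: cvg_cst.
exact: exprn_continuous.
Qed.

Lemma free_energy_EVT a b (x y : R) : x <= y ->
  exists2 m, x <= m <= y & forall v, x <= v <= y -> free_energy a b v <= free_energy a b m.
Proof.
move=> xy; have [|c cab cmax] := @EVT_max R (free_energy a b) x y xy.
  by apply: continuous_subspaceT; exact: free_energy_continuous.
exists c; first by move: cab; rewrite in_itv.
by move=> v vxy; apply: cmax; rewrite in_itv.
Qed.

Definition maximizer a b u :=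
  0 <= u <= 1 /\ forall v, 0 <= v <= 1 -> free_energy a b v <= free_energy a b u.

Lemma maximizer_exists a b : exists u, maximizer a b u.
Proof. by have [u u01 h] := free_energy_EVT a b (@ler01 R); exists u. Qed.

Lemma maximizer_fixpoint a b u : 0 <= b -> maximizer a b u ->
  u = logistic (2 * a + 6 * b * u ^+ 2).
Proof.
move=> b0 [u01 umax]; apply/eqP; apply/negPn/negP => /(free_energy_logistic_gt b0 u01).
have /andP[v0 v1] := logistic_itv (2 * a + 6 * b * u ^+ 2).
by apply/negP; rewrite -leNgt; apply: umax; rewrite !ltW.
Qed.

Lemma maximizer_itv a b u : 0 <= b -> maximizer a b u -> 0 < u < 1.
Proof. by move=> b0 /(maximizer_fixpoint b0) ->; exact: logistic_itv. Qed.

(** Add the two optimality inequalities: all terms cancel except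
    [(b' - b) (u'^3 - u^3) >= 0]. *)
Lemma maximizer_le a b b' u u' : b < b' ->
  maximizer a b u -> maximizer a b' u' -> u <= u'.
Proof.
move=> bb' [u01 umax] [u'01 u'max].
have := umax _ u'01; have := u'max _ u01; rewrite /free_energy => h1 h2.
have : 0 <= (b' - b) * (u' ^+ 3 - u ^+ 3) by lra.
rewrite pmulr_rge0 ?subr_gt0// subr_ge0.
by rewrite ler_pXn2r ?nnegrE//; [case/andP: u01|case/andP: u'01].
Qed.

Lemma is_derive_entropy u : 0 < u < 1 ->
  is_derive u 1 entropy (ln (1 - u) - ln u).
Proof.
move=> /andP[u0 u1].
have dx v : 0 < v -> is_derive v 1 (fun x : R => x * ln x) (ln v + 1).
  move=> v0.
  have d1 : is_derive v 1 (@ln R) v^-1 by exact: is_derive1_ln.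
  apply: (is_derive_eq (is_deriveM (is_derive_id v 1) d1)).
  by rewrite /GRing.scale/= divff ?gt_eqF// mulr1 addrC.
have u1' : 0 < 1 - u by lra.
have dv : is_derive u 1 (fun x : R => 1 - x) (0 - 1).
  by have := is_deriveB (is_derive_cst (1 : R^o) u (1 : R^o))
    (is_derive_id (u : R^o) (1 : R^o)).
have dc := @is_derive1_comp R (fun x => x * ln x) (fun x => 1 - x) u _ _ (dx _ u1') dv.
apply: (is_derive_eq (is_deriveN (is_deriveD (dx _ u0) dc))).
rewrite /=; ring.
Qed.

Lemma is_derive_free_energy a b u : 0 < u < 1 ->
  is_derive u 1 (free_energy a b) (a + 3 * b * u ^+ 2 + (ln (1 - u) - ln u) / 2).
Proof.
move=> u01.
have d1 := is_deriveZ a (is_derive_id u (1 : R)).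
have d2 := is_deriveZ b (is_deriveX 3 (is_derive_id u (1 : R))).
have d3 := is_deriveZ 2^-1 (is_derive_entropy u01).
have := is_derive_eq (is_deriveD (is_deriveD d1 d2) d3) _.
have -> : (a \*: id + b \*: id ^+ 3 + 2^-1 \*: entropy) = free_energy a b.
  apply/funext => x; rewrite /free_energy.
  transitivity (a * x + b * ((id : R -> R) ^+ 3) x + 2^-1 * entropy x) => //.
  by rewrite [entropy x / 2]mulrC.
apply; rewrite /GRing.scale/=; ring.
Qed.

(** The condition [L'' u <= 0] at an interior maximum, after multiplication by
    [2 u (1 - u)].  If it failed, then [L' > 0] on an interval to the right of
    [u], contradicting maximality by the mean value theorem. *)
Lemma maximizer_second_order a b u : 0 <= b -> maximizer a b u ->
  12 * b * u ^+ 2 * (1 - u) <= 1.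
Proof.
move=> b0 um; have /andP[u0 u1] := maximizer_itv b0 um.
rewrite leNgt; apply/negP => h.
pose k := 12 * b * u ^+ 2 - 1.
have k0 : u < k * (1 - u) by rewrite /k; lra.
have kpos : 0 < k by rewrite -(@pmulr_lgt0 _ (1 - u)); lra.
(* [w] is chosen so that [u < k * w], that is [12 b u > 1 / u + 1 / w]; this
   makes [L' c] positive for all [c] between [u] and [1 - w]. *)
pose w := (u / k + (1 - u)) / 2.
have uk : u / k < 1 - u by rewrite ltr_pdivrMr// mulrC.
have uk0 : 0 < u / k by rewrite divr_gt0.
have w0 : 0 < w by rewrite /w; lra.
have kw : u < k * w.
  by rewrite -ltr_pdivrMl// mulrC /w; lra.
have w1 : u < 1 - w by rewrite /w; lra.
have [| |c] := @MVT R (free_energy a b)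
    (fun v => a + 3 * b * v ^+ 2 + (ln (1 - v) - ln v) / 2) u (1 - w) w1.
- move=> x; rewrite in_itv/= => /andP[x0 x1]; apply: is_derive_free_energy; lra.
- by apply: continuous_subspaceT; exact: free_energy_continuous.
rewrite in_itv/= => /andP[c0 c1'] hmvt.
have : free_energy a b (1 - w) <= free_energy a b u by case: um => _; apply; lra.
(* It remains to see that the derivative at [c] is positive; [lnu] below says
   that it vanishes at [u]. *)
rewrite -subr_le0 hmvt pmulr_lle0 ?subr_gt0// leNgt => /negP; apply.
have := ln_logistic (2 * a + 6 * b * u ^+ 2); rewrite -maximizer_fixpoint// => lnu.
have uc : u != c by rewrite lt_eqF.
have h1 := xlnx_tangent (ltW u0) (lt_trans u0 c0) uc.
have cpos : 0 < 1 - c by lra.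
have upos : 0 < 1 - u by lra.
have cu : 1 - c != 1 - u by rewrite lt_eqF//; lra.
have h2 := xlnx_tangent (ltW cpos) upos cu.
have {h1} : ln c - ln u < (c - u) / u by rewrite ltr_pdivlMr// mulrC.
have {h2} : ln (1 - u) - ln (1 - c) < (c - u) / w.
  rewrite ltr_pdivlMr// mulrC.
  apply: le_lt_trans (_ : (1 - c) * (ln (1 - u) - ln (1 - c)) < _); last by lra.
  by rewrite ler_wpM2r ?subr_ge0 ?ler_ln ?posrE//; lra.
have : (c - u) / u + (c - u) / w < (c - u) * (12 * b * u).
  rewrite -mulrDr ltr_pM2l ?subr_gt0//.
  have -> : u^-1 + w^-1 = (u + w) / (u * w) by field; rewrite !gt_eqF.
  rewrite ltr_pdivrMr ?(mulr_gt0 u0 w0)//.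
  have -> : 12 * b * u * (u * w) = (k + 1) * w by rewrite /k; ring.
  lra.
have : 0 <= b * (c - u) ^+ 2 by rewrite mulr_ge0 ?sqr_ge0.
lra.
Qed.

(** For [u <= c2] one has [1 <= - 2 a (1 - u)], so the second-order condition
    forces [6 b u^2 <= - a] and the fixed-point equation gives
    [u <= logistic a = c1].  Since [c1 < c2], the first inequality was strict,
    and running the argument again makes the conclusion strict. *)
Lemma maximizer_dichotomy a b u : a < 0 -> c1 a < c2 a -> 0 <= b ->
  maximizer a b u -> u < c1 a \/ c2 a < u.
Proof.
move=> a0 c12 b0 um; case: (leP u (c2 a)) => [uc2|]; [left|by right].
have ufix := maximizer_fixpoint b0 um.
have uso := maximizer_second_order b0 um.
have /andP[u0 u1] := maximizer_itv b0 um.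
have h x : x <= c2 a -> 1 <= - 2 * a * (1 - x).
  rewrite /c2 => xc; have : - 2 * a * - (2 * a)^-1 <= - 2 * a * (1 - x).
    by rewrite ler_pM2l; lra.
  by have -> : - 2 * a * - (2 * a)^-1 = 1 by field; rewrite lt_eqF.
have le : 6 * b * u ^+ 2 <= - a.
  rewrite leNgt; apply/negP => gt.
  have : - a * (1 - u) < 6 * b * u ^+ 2 * (1 - u) by rewrite ltr_pM2r; lra.
  have := h _ uc2; lra.
have uc1 : u <= c1 a.
  move: le; rewrite le_eqVlt => /predU1P[e|lt].
    by rewrite ufix e /c1 -/(logistic _) [X in logistic X](_ : _ = a)//; lra.
  apply: ltW; rewrite ufix /c1 -/(logistic a); apply: logistic_homo; lra.
have lt : 6 * b * u ^+ 2 < - a.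
  rewrite lt_neqAle le andbT; apply/eqP => e.
  have uc2' := le_lt_trans uc1 c12.
  have h3 : 1 - c2 a < 1 - u by lra.
  have : - 2 * a * (1 - c2 a) < - 2 * a * (1 - u) by rewrite ltr_pM2l; lra.
  have e2 : 12 * b * u ^+ 2 = - 2 * a by lra.
  move: uso; rewrite e2; have := h _ (lexx _); lra.
by rewrite ufix /c1 -/(logistic a); apply: logistic_homo; lra.
Qed.

Lemma entropy_le1 u : 0 <= u <= 1 -> entropy u <= 1.
Proof.
move=> /andP[u0 u1].
have xl (x : R) : 0 <= x <= 1 -> - (x * ln x) <= 1 - x.
  move=> /andP[x0 x1]; have [->|x1'] := eqVneq x 1; first by rewrite ln1; lra.
  by have := xlnx_tangent x0 ltr01 x1'; rewrite ln1 sub0r mulrN => /ltW.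
rewrite /entropy.
have hu := xl u; have h1u := xl (1 - u).
have : - (u * ln u) <= 1 - u by apply: hu; rewrite u0.
have : - ((1 - u) * ln (1 - u)) <= 1 - (1 - u) by apply: h1u; apply/andP; split; lra.
lra.
Qed.

(** Compare the value at [u] with the value [a + b] at [1]: as [b] grows the
    cubic term makes small densities suboptimal.  This bounds the threshold. *)
Lemma maximizer_lt_bound a b u c : a < 0 -> 0 <= b -> c < 1 ->
  maximizer a b u -> u < c -> b <= (1 / 2 - a) / (1 - c ^+ 3).
Proof.
move=> a0 b0 cl1 [u01 umax] uc.
have /umax : 0 <= (1 : R) <= 1 by rewrite ler01 lexx.
have := entropy_le1 u01; case/andP: u01 => u0 u1.
rewrite /free_energy {2}/entropy subrr ln1 !mulr0 mul0r addr0 oppr0.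
rewrite ler_pdivlMr; last by rewrite subr_gt0 exprn_ilt1//; lra.
have : b * u ^+ 3 <= b * c ^+ 3.
  by rewrite ler_wpM2l// ler_pXn2r ?nnegrE//; lra.
have : a * 1 <= a * 0 by rewrite ler_nM2l//; lra.
have : 0 <= - a * u by rewrite mulr_ge0//; lra.
lra.
Qed.

Lemma maximizer_gap a b (x y : R) u : 0 <= x -> x <= y -> y <= 1 ->
  maximizer a b u -> (forall v, maximizer a b v -> ~~ (x <= v <= y)) ->
  exists2 eta, 0 < eta & forall v, x <= v <= y -> free_energy a b v <= free_energy a b u - eta.
Proof.
move=> x0 xy y1 [u01 umax] hno.
have [m mxy mmax] := free_energy_EVT a b xy.
have m01 : 0 <= m <= 1 by case/andP: mxy => m0 m1; apply/andP; split; lra.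
exists (free_energy a b u - free_energy a b m); last by move=> v /mmax; lra.
rewrite subr_gt0 ltNge; apply/negP => mu.
have /hno : maximizer a b m.
  by split=> // v /umax vu; exact: le_trans vu mu.
by rewrite mxy.
Qed.
End variational_problem.

(** * The threshold in the triangle parameter *)

Section threshold.
Local Open Scope classical_set_scope.
Local Open Scope ring_scope.
Variable R : realType.

(** After adding [eta * v] to the functional, its maximum is still less than
    [L u + eta * c] for some interior [u]: a linear tilt whose gain falls short
    of what the level [c] would require.  Positive [eta] rules out densities
    above [c], negative [eta] rules out densities below [c]. *)
Definition separates (a b eta c : R) :=
  exists u L, [/\ 0 < u < 1,
    forall v, 0 <= v <= 1 -> free_energy (a + eta) b v <= L & L < free_energy a b u + eta * c].

Lemma c1_itv (a : R) : 0 < c1 a < 1.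
Proof. exact: logistic_itv. Qed.

Lemma free_energyD (a b eta v : R) : free_energy (a + eta) b v = free_energy a b v + eta * v.
Proof. by rewrite /free_energy; ring. Qed.

(** On the far side of [u0], strictly between the maximizers and [c], the
    functional stays [eta] below its maximum by compactness; that gap absorbs
    the tilt, since densities are at most [1]. *)
Lemma separates_above (a b : R) u' c : 0 <= b -> c <= 1 -> 0 <= u' < c ->
  (forall u, maximizer a b u -> u <= u') -> exists2 eta, 0 < eta & separates a b eta c.
Proof.
move=> b0 cle1 /andP[u'0 u'c] umax.
have [u um] := maximizer_exists a b.
pose u0 := (u' + c) / 2.
have [||||eta eta0 heta] := @maximizer_gap R a b u0 1 u _ _ _ um.
- by rewrite /u0; lra.
- by rewrite /u0; lra.
- by [].
- by move=> v /umax vu'; apply/negP => /andP[]; rewrite /u0; lra.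
exists eta => //; exists u, (free_energy a b u + eta * u0); split.
- exact: maximizer_itv um.
- move=> v /andP[v0 v1]; rewrite free_energyD.
  have [vu0|vu0] := leP v u0.
    by rewrite lerD ?ler_pM2l//; case: um => _; apply; rewrite v0.
  have /heta : u0 <= v <= 1 by rewrite ltW.
  have : eta * v <= eta * 1 by rewrite ler_pM2l.
  have : 0 <= eta * u0 by rewrite mulr_ge0 ?ltW//; rewrite /u0; lra.
  by lra.
- by rewrite ltrD2l ltr_pM2l// /u0; lra.
Qed.

Lemma separates_below (a b : R) u' c : 0 <= b -> 0 <= c -> c < u' <= 1 ->
  (forall u, maximizer a b u -> u' <= u) -> exists2 eta, 0 < eta & separates a b (- eta) c.
Proof.
move=> b0 c0 /andP[cu' u'1] umax.
have [u um] := maximizer_exists a b.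
pose u0 := (u' + c) / 2.
have [||||eta eta0 heta] := @maximizer_gap R a b 0 u0 u _ _ _ um.
- by [].
- by rewrite /u0; lra.
- by rewrite /u0; lra.
- by move=> v /umax vu'; apply/negP => /andP[_]; rewrite /u0; lra.
exists eta => //; exists u, (free_energy a b u - eta * u0); split.
- exact: maximizer_itv um.
- move=> v /andP[v0 v1]; rewrite free_energyD mulNr.
  have [vu0|vu0] := leP u0 v.
    by rewrite lerD ?lerN2 ?ler_pM2l//; case: um => _; apply; rewrite v0.
  have /heta : 0 <= v <= u0 by rewrite v0 ltW.
  have : eta * u0 <= eta * 1 by rewrite ler_pM2l// /u0; lra.
  have : 0 <= eta * v by rewrite mulr_ge0 ?(ltW eta0).
  by lra.
- by rewrite mulNr ltrD2l ltrN2 ltr_pM2l// /u0; lra.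
Qed.

(** The threshold is the supremum of the parameters [b >= 0] that have a
    maximizer below [c1]. *)
Lemma threshold_exists (a : R) : a < 0 -> c1 a < c2 a ->
  exists q, [/\ 0 <= q,
    forall b, 0 <= b < q -> exists2 eta, 0 < eta & separates a b eta (c1 a) &
    forall b, q < b -> exists2 eta, 0 < eta & separates a b (- eta) (c2 a)].
Proof.
move=> a0 c12; have /andP[c1_gt0 c1_lt1] := c1_itv a.
pose S := [set b : R | 0 <= b /\ exists2 u, maximizer a b u & u < c1 a].
have S0 : S 0.
  split=> //; have [u um] := maximizer_exists a 0; exists u => //.
  rewrite (maximizer_fixpoint (lexx 0) um) /c1 -/(logistic a).
  by apply: logistic_homo; rewrite mulr0 mul0r addr0; lra.
have Sub : has_ubound S.
  exists ((1 / 2 - a) / (1 - c1 a ^+ 3)) => b [b0 [u um uc]].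
  exact: maximizer_lt_bound um uc.
exists (sup S); split.
- exact: ub_le_sup.
- move=> b /andP[b0 bq].
  (* [b] is below some [b'] in [S], whose maximizer dominates all those of
     [b]. *)
  have [|b' [b'0 [u' u'm u'c]] bb'] := sup_gt _ bq; first by exists 0.
  apply: (@separates_above _ _ u') => //; first exact: ltW.
    by have /andP[/ltW -> _] := maximizer_itv b'0 u'm.
  by move=> u um; exact: maximizer_le um u'm.
move=> b qb; have q0 : 0 <= sup S by exact: ub_le_sup.
pose b' := (sup S + b) / 2.
have b'0 : 0 <= b' by rewrite /b'; lra.
have [u' u'm] := maximizer_exists a b'.
have cu' : c2 a < u'.
  have [u'c|//] := maximizer_dichotomy a0 c12 b'0 u'm.
  have : b' <= sup S by apply: ub_le_sup => //; split => //; exists u'.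
  by rewrite /b'; lra.
apply: (@separates_below _ _ u'); try lra.
  by have /andP[_ /ltW ->] := maximizer_itv b'0 u'm; rewrite cu'.
by move=> u um; apply: maximizer_le u'm um; rewrite /b'; lra.
Qed.
End threshold.

(** * Averages over the classes of a finite partition *)

Section block_average.
Variables (R : realType) (X : finType) (D : eqType).
Implicit Types (k : X -> D) (f g : X -> R).

(** Conditional expectation of [f] given [k] under the uniform measure on [X]. *)
Definition average k f x : R :=
  (\sum_(y | k y == k x) f y) / #|[pred y | k y == k x]|%:R.

Lemma card_block_gt0 k x : 0 < #|[pred y | k y == k x]|%:R :> R.
Proof. by rewrite ltr0n; apply/card_gt0P; exists x; rewrite inE. Qed.

Lemma eq_average k f x y : k x = k y -> average k f x = average k f y.
Proof. by rewrite /average => ->. Qed.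

(** The averaging operator is self-adjoint and fixes functions of [k]. *)
Lemma sum_averageM k f g : (forall x y, k x = k y -> g x = g y) ->
  \sum_x average k f x * g x = \sum_x f x * g x.
Proof.
move=> gk.
transitivity (\sum_x \sum_(y | k y == k x)
    f y * (g y / #|[pred z | k z == k y]|%:R)).
  apply: eq_bigr => x _; rewrite /average mulr_suml mulr_suml.
  by apply: eq_bigr => y /eqP kyx; rewrite kyx (gk _ _ kyx) mulrAC mulrA.
rewrite (exchange_big_dep predT)//=; apply: eq_bigr => y _.
rewrite sumr_const -[LHS]mulr_natr (eq_card (B := [pred z | k z == k y])); last first.
  by move=> z; rewrite !inE eq_sym.
by rewrite -mulrA divfK// gt_eqF// card_block_gt0.
Qed.

Lemma sum_average k f : \sum_x average k f x = \sum_x f x.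
Proof.
have := @sum_averageM k f (fun=> 1) (fun _ _ _ => erefl).
by under eq_bigr do rewrite mulr1; under [in RHS]eq_bigr do rewrite mulr1.
Qed.

Lemma average_compl k f x : average k (fun y => 1 - f y) x = 1 - average k f x.
Proof.
rewrite /average sumrB mulrBl; congr (_ - _).
by rewrite sumr_const divff// gt_eqF// card_block_gt0.
Qed.

Lemma average_ge0 k f x : (forall y, 0 <= f y) -> 0 <= average k f x.
Proof. by move=> f0; rewrite divr_ge0 ?sumr_ge0. Qed.

Lemma average_gt0 k f x : (forall y, 0 <= f y) -> 0 < f x -> 0 < average k f x.
Proof.
move=> f0 fx; rewrite divr_gt0 ?card_block_gt0// (bigD1 x)//=.
by rewrite ltr_pwDl// sumr_ge0.
Qed.

Lemma average_le1 k f x : (forall y, f y <= 1) -> average k f x <= 1.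
Proof.
move=> f1; rewrite -subr_ge0 -average_compl; apply: average_ge0 => y.
by rewrite subr_ge0.
Qed.

Lemma average_lt1 k f x : (forall y, f y <= 1) -> f x < 1 -> average k f x < 1.
Proof.
move=> f1 fx; rewrite -subr_gt0 -average_compl; apply: average_gt0.
  by move=> y; rewrite subr_ge0.
by rewrite subr_gt0.
Qed.

Lemma average_involution k f (s : X -> X) x : involutive s ->
  (forall y, f (s y) = f y) -> (forall y z, (k (s y) == k (s z)) = (k y == k z)) ->
  average k f (s x) = average k f x.
Proof.
move=> sK fs ks; rewrite /average (reindex_inj (inv_inj sK)) /=.
have -> : #|[pred y | k y == k (s x)]| = #|[pred y | k y == k x]|.
  rewrite -!sum1_card (reindex_inj (inv_inj sK)) /=.
  by apply: eq_bigl => y; rewrite !inE ks.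
by congr (_ / _); apply: eq_big => [y|y _]; [rewrite ks|rewrite fs].
Qed.

(** Refining the partition increases the energy by the squared distance of the
    two averages, which is at least [2 e <D, g> - e^2 <g, g>] for every test
    function [g] and scalar [e], with [D] the difference of the averages.  On
    functions of [k'], the finer average may be replaced by [f]. *)
Lemma energy_increment k k' f g (e : R) :
  (forall x y, k' x = k' y -> k x = k y) ->
  (forall x y, k' x = k' y -> g x = g y) ->
  2 * e * \sum_x (f x - average k f x) * g x - e ^+ 2 * \sum_x g x ^+ 2 <=
  \sum_x average k' f x ^+ 2 - \sum_x average k f x ^+ 2.
Proof.
move=> kk' gk'.
have avk x y : k' x = k' y -> average k f x = average k f y.
  by move=> /kk'; exact: eq_average.
have e1 : \sum_x average k' f x * average k f x = \sum_x average k f x ^+ 2.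
  rewrite (sum_averageM _ avk) -(@sum_averageM k f)//.
  by move=> x y; exact: eq_average.
have e2 := sum_averageM f gk'.
have : 0 <= \sum_x (average k' f x - average k f x - e * g x) ^+ 2.
  by apply: sumr_ge0 => x _; exact: sqr_ge0.
have -> : \sum_x (average k' f x - average k f x - e * g x) ^+ 2 =
  \sum_x average k' f x ^+ 2 + \sum_x average k f x ^+ 2 + e ^+ 2 * \sum_x g x ^+ 2
  - 2 * (\sum_x average k' f x * average k f x)
  - 2 * e * (\sum_x average k' f x * g x) + 2 * e * \sum_x average k f x * g x.
  rewrite !mulr_sumr -!big_split/= -!sumrB -!big_split/=.
  by apply: eq_bigr => x _; ring.
have -> : \sum_x (f x - average k f x) * g x = \sum_x f x * g x - \sum_x average k f x * g x.
  by rewrite -sumrB; apply: eq_bigr => x _; rewrite mulrBl.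
rewrite e1 e2; lra.
Qed.
End block_average.

(** * Weak regularity and triangle counts *)

Section weak_regularity.
Variables (R : realType) (V : finType).
Implicit Types (P : V -> nat) (S T : V -> bool) (f r B : V * V -> R).

Definition block P (p : V * V) : nat * nat := (P p.1, P p.2).

(** A one-sided version of the cut norm being at most [d]. *)
Definition cut_bounded r (d : R) :=
  forall S T, \sum_p r p * (S p.1 && T p.2)%:R <= d.

(** A bilinear form is maximized over the cube at a vertex: round [x] to the
    set where its coefficient is positive, then [y] likewise. *)
Lemma cut_bounded_weighted r d (x y : V -> R) : cut_bounded r d ->
  (forall v, 0 <= x v <= 1) -> (forall v, 0 <= y v <= 1) ->
  \sum_p r p * (x p.1 * y p.2) <= d.
Proof.
move=> rd x01 y01.
have clip (t c : R) : 0 <= t <= 1 -> t * c <= (0 < c)%R%:R * c.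
  move=> /andP[t0 t1]; case: ltP => c0; first by rewrite ler_wpM2r ?(ltW c0).
  by rewrite mul0r mulr_ge0_le0.
pose S i := 0 < \sum_j r (i, j) * y j.
pose T j := 0 < \sum_i r (i, j) * (S i)%:R.
apply: le_trans (rd S T).
have -> : \sum_p r p * (x p.1 * y p.2) = \sum_i x i * \sum_j r (i, j) * y j.
  under [RHS]eq_bigr do rewrite mulr_sumr.
  by rewrite pair_bigA; apply: eq_bigr => -[i j] _ /=; ring.
apply: (@le_trans _ _ (\sum_i (S i)%:R * \sum_j r (i, j) * y j)).
  by apply: ler_sum => i _; exact: clip.
have -> : \sum_i (S i)%:R * (\sum_j r (i, j) * y j) =
          \sum_j y j * \sum_i r (i, j) * (S i)%:R.
  under eq_bigr do rewrite mulr_sumr; under [RHS]eq_bigr do rewrite mulr_sumr.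
  by rewrite exchange_big; apply: eq_bigr => j _; apply: eq_bigr => i _; ring.
apply: (@le_trans _ _ (\sum_j (T j)%:R * \sum_i r (i, j) * (S i)%:R)).
  by apply: ler_sum => j _; exact: clip.
under eq_bigr do rewrite mulr_sumr.
rewrite exchange_big pair_bigA; apply: ler_sum => -[i j] _ /=.
by rewrite -mulnb natrM [_%:R * (_ * _)]mulrC mulrA.
Qed.

Definition refine P S T v : nat := (4 * P v + 2 * S v + T v)%N.

(** A pair of sets witnessing a large discrepancy gives a refinement whose energy
    is larger by [eps^2] of the total mass. *)
Lemma weak_regularity_step P f (eps : R) S T : 0 <= eps ->
  eps * #|{: V * V}|%:R < \sum_p (f p - average (block P) f p) * (S p.1 && T p.2)%:R ->
  eps ^+ 2 * #|{: V * V}|%:R <=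
  \sum_p average (block (refine P S T)) f p ^+ 2 - \sum_p average (block P) f p ^+ 2.
Proof.
move=> eps0 big; set P' := refine P S T.
have dec u v : P' u = P' v -> [/\ P u = P v, S u = S v & T u = T v].
  by rewrite /P' /refine; case: (S u); case: (S v); case: (T u); case: (T v) => /= h;
    split=> //; try lia; exfalso; lia.
apply: (le_trans _ (@energy_increment R _ _ (block P) (block P') f
  (fun p => (S p.1 && T p.2)%:R) eps _ _)).
- have : \sum_(p : V * V) (S p.1 && T p.2)%:R ^+ 2 <= #|{: V * V}|%:R :> R.
    rewrite -sum1_card natr_sum; apply: ler_sum => p _.
    by case: (_ && _); rewrite ?expr1n// expr0n.
  move=> h; have : eps ^+ 2 * \sum_(p : V * V) (S p.1 && T p.2)%:R ^+ 2 <=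
      eps ^+ 2 * #|{: V * V}|%:R.
    by rewrite ler_wpM2l// exprn_ge0.
  have : 2 * eps * (eps * #|{: V * V}|%:R) <=
      2 * eps * \sum_p (f p - average (block P) f p) * (S p.1 && T p.2)%:R.
    by rewrite ler_wpM2l ?(ltW big)//; lra.
  lra.
- by move=> p q [/dec[h1 _ _] /dec[h2 _ _]]; rewrite /block h1 h2.
- by move=> p q [/dec[_ h1 _] /dec[_ _ h2]]; rewrite h1 h2.
Qed.

(** Energy increment in the style of Frieze and Kannan: the energy is at most the
    number of pairs, so fewer than [m] refinements can occur when
    [m * eps^2 > 1]; each one multiplies the number of colours by [4]. *)
Lemma weak_regularity f (eps : R) m : (0 < #|V|)%N -> 0 <= eps ->
  1 < m%:R * eps ^+ 2 -> (forall p, 0 <= f p <= 1) ->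
  exists2 P, forall v, (P v < 4 ^ m)%N &
    cut_bounded (fun p => f p - average (block P) f p) (eps * #|{: V * V}|%:R).
Proof.
move=> V0 eps0 hm f01; set N := #|{: V * V}|%:R.
have N0 : 0 < N by rewrite ltr0n card_prod muln_gt0 V0.
pose good P := cut_bounded (fun p => f p - average (block P) f p) (eps * N).
have [[P Pm gP]|[P Pm hP]] : (exists2 P, forall v, (P v < 4 ^ m)%N & good P) \/
  (exists2 P, forall v, (P v < 4 ^ m)%N &
     m%:R * eps ^+ 2 * N <= \sum_p average (block P) f p ^+ 2); last 1 first.
- exfalso; move: hP; apply/negP; rewrite -ltNge.
  apply: (@le_lt_trans _ _ N); last by rewrite ltr_pMl.
  rewrite /N -sum1_card natr_sum; apply: ler_sum => p _.
  rewrite expr_le1// ?average_le1// ?average_ge0//.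
  + by move=> q; case/andP: (f01 q).
  + by move=> q; case/andP: (f01 q).
- elim: m {hm} => [|m [[P Pm gP]|[P Pm hP]]].
  + by right; exists (fun=> 0%N) => //; rewrite !mul0r sumr_ge0// => p _; exact: sqr_ge0.
  + by left; exists P => // v; have := Pm v; rewrite expnS; lia.
  have [gP|/existsNP[S /existsNP[T /negP]]] := pselect (good P).
    by left; exists P => // v; have := Pm v; rewrite expnS; lia.
  rewrite -ltNge => /(weak_regularity_step eps0) h; right.
  exists (refine P S T).
    by move=> v; have := Pm v; rewrite /refine expnS; case: (S v); case: (T v); lia.
  by move: h; rewrite -natr1 -/N; lra.
- by exists P.
Qed.

(** The trace of the cube of the matrix [f]. *)
Definition triangle_sum f := \sum_i \sum_j \sum_k f (i, j) * f (j, k) * f (k, i).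

(** Replace the three factors [f] by [B] one at a time.  Once the vertex not
    incident to the replaced pair is fixed, each change is a bilinear form in
    [f - B] with weights between [0] and [1]. *)
Lemma triangle_sum_cut f B d : cut_bounded (fun p => f p - B p) d ->
  (forall p, 0 <= f p <= 1) -> (forall p, 0 <= B p <= 1) ->
  triangle_sum f <= triangle_sum B + 3 * #|V|%:R * d.
Proof.
move=> hd f01 B01; rewrite -lerBlDl.
have cw (x y : V -> R) : (forall v, 0 <= x v <= 1) -> (forall v, 0 <= y v <= 1) ->
    \sum_i \sum_j (f (i, j) - B (i, j)) * (x i * y j) <= d.
  move=> x01 y01; apply: le_trans (cut_bounded_weighted hd x01 y01).
  by rewrite pair_bigA; apply: ler_sum => -[i j].
have -> : triangle_sum f - triangle_sum B =
  \sum_k \sum_i \sum_j (f (i, j) - B (i, j)) * (f (k, i) * f (j, k)) +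
  \sum_i \sum_j \sum_k (f (j, k) - B (j, k)) * (B (i, j) * f (k, i)) +
  \sum_j \sum_k \sum_i (f (k, i) - B (k, i)) * (B (j, k) * B (i, j)).
  rewrite /triangle_sum.
  have rot (F : V -> V -> V -> R) :
      \sum_k \sum_i \sum_j F i j k = \sum_i \sum_j \sum_k F i j k.
    by rewrite exchange_big; apply: eq_bigr => i _; rewrite exchange_big.
  rewrite (rot (fun i j k => (f (i, j) - B (i, j)) * (f (k, i) * f (j, k)))).
  rewrite (rot (fun k i j => (f (k, i) - B (k, i)) * (B (j, k) * B (i, j)))).
  rewrite [X in _ = _ + X](rot (fun i j k => (f (k, i) - B (k, i)) * (B (j, k) * B (i, j)))).
  rewrite -sumrB -!big_split; apply: eq_bigr => i _ /=.
  rewrite -sumrB -!big_split; apply: eq_bigr => j _ /=.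
  rewrite -sumrB -!big_split; apply: eq_bigr => k _ /=; ring.
have bound (F : V -> R) : (forall v, F v <= d) -> \sum_v F v <= #|V|%:R * d.
  move=> Fd; rewrite mulr_natl -sumr_const; apply: ler_sum => v _; exact: Fd.
have -> : 3 * #|V|%:R * d = #|V|%:R * d + #|V|%:R * d + #|V|%:R * d by ring.
rewrite !lerD//; apply: bound => v.
- exact: (cw (fun i => f (v, i)) (fun j => f (j, v))).
- exact: (cw (fun j => B (v, j)) (fun k => f (k, v))).
- exact: (cw (fun k => B (v, k)) (fun i => B (i, v))).
Qed.

(** Apply [3 x y z <= x^3 + y^3 + z^3] to each triple; every pair then occurs
    once for each third vertex. *)
Lemma triangle_sum_le_cube B : (forall p, 0 <= B p) ->
  triangle_sum B <= #|V|%:R * \sum_p B p ^+ 3.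
Proof.
move=> B0; rewrite /triangle_sum.
have amgm (x y z : R) : 0 <= x -> 0 <= y -> 0 <= z ->
    x * y * z <= (x ^+ 3 + y ^+ 3 + z ^+ 3) / 3.
  move=> x0 y0 z0; have : 0 <= (x + y + z) * ((x - y) ^+ 2 + (y - z) ^+ 2 + (z - x) ^+ 2).
    by rewrite mulr_ge0 ?addr_ge0 ?sqr_ge0.
  lra.
apply: le_trans
  (_ : \sum_i \sum_j \sum_k (B (i, j) ^+ 3 + B (j, k) ^+ 3 + B (k, i) ^+ 3) / 3 <= _).
  by apply: ler_sum => i _; apply: ler_sum => j _; apply: ler_sum => k _; exact: amgm.
have e : \sum_p B p ^+ 3 = \sum_i \sum_j B (i, j) ^+ 3.
  by rewrite pair_bigA; apply: eq_bigr => -[].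
rewrite le_eqVlt; apply/orP; left; apply/eqP.
under eq_bigr do under eq_bigr do rewrite -mulr_suml.
under eq_bigr do rewrite -mulr_suml; rewrite -mulr_suml.
under eq_bigr do under eq_bigr do rewrite !big_split/= sumr_const.
under eq_bigr do rewrite !big_split/= sumr_const.
rewrite !big_split/= sumr_const.
under [X in X + _ + _]eq_bigr do rewrite sumrMnl.
rewrite sumrMnl [X in _ + X]sumrMnl [X in _ + X *+ _]exchange_big -e.
rewrite mulr_natl -/(#|V|); move: (_ *+ #|V|) => z.
by field.
Qed.
End weak_regularity.

(** * Sums and products over edges *)

Section graph_sums.
Variables (R : realType) (n : nat).
Implicit Types (G : simple_graph n) (e A : {set 'I_n}).
Local Notation V := 'I_n.

Definition adjacency G (p : V * V) : R := ([set p.1; p.2] \in edges G)%:R.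

Lemma edge_card2 G e : e \in edges G -> #|e| = 2%N.
Proof. by have /forall_inP h := valP G => /h/eqP. Qed.

Lemma edge_neq G (i j : V) : [set i; j] \in edges G -> i != j.
Proof. by move=> /edge_card2; rewrite cards2; case: eqP. Qed.

Lemma adjacency_itv G p : 0 <= adjacency G p <= 1.
Proof. by rewrite /adjacency; case: (_ \in _); rewrite ?lexx ?ler01. Qed.

Lemma adjacency_sym G i j : adjacency G (i, j) = adjacency G (j, i).
Proof. by rewrite /adjacency/= finset.setUC. Qed.

Lemma adjacency_diag G i : adjacency G (i, i) = 0.
Proof.
rewrite /adjacency/=; case: (boolP (_ \in _)) => // /edge_neq.
by rewrite eqxx.
Qed.

Lemma eq_set2 (x y i j : V) : x != y ->
  ([set i; j] == [set x; y]) = ((i == x) && (j == y)) || ((i == y) && (j == x)).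
Proof.
move=> xy; apply/eqP/idP => [h|].
  have : x \in [set i; j] by rewrite h finset.set21.
  have : y \in [set i; j] by rewrite h finset.set22.
  rewrite !inE => /orP[]/eqP yE /orP[]/eqP xE; move: xy;
    by rewrite xE yE !eqxx ?orbT.
by case/orP => /andP[/eqP-> /eqP->]//; rewrite finset.setUC.
Qed.

Lemma sum_pairs_edge (F : V * V -> R) x y : x != y ->
  \sum_(p | (p.1 != p.2) && ([set p.1; p.2] == [set x; y])) F p =
  F (x, y) + F (y, x).
Proof.
move=> xy; rewrite (bigD1 (x, y)) ?xy ?eqxx//=; congr (_ + _).
rewrite (big_pred1 (y, x))// => -[i j] /=.
rewrite eq_set2// !xpair_eqE.
apply/idP/idP.
  by case/andP => /andP[_ /orP[h|//]]; rewrite h.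
case/andP => /eqP -> /eqP ->.
by rewrite !eqxx [y == x]eq_sym (negPf xy).
Qed.

(** Every 2-set arises from exactly two ordered pairs. *)
Lemma sum_pairs (F : {set V} -> R) :
  \sum_(p : V * V | p.1 != p.2) F [set p.1; p.2] = 2 * \sum_(e : {set V} | #|e| == 2%N) F e.
Proof.
rewrite (partition_big (fun p : V * V => [set p.1; p.2]) (fun e => #|e| == 2%N))/=; last first.
  by move=> [i j] /= ij; rewrite cards2 ij.
rewrite mulr_sumr; apply: eq_bigr => e /cards2P[x [y [xy ->]]].
rewrite (eq_bigr (fun=> F [set x; y])); last by move=> p /andP[_ /eqP->].
by rewrite (sum_pairs_edge (fun=> F [set x; y]))//; ring.
Qed.

Lemma sum_adjacency G : \sum_p adjacency G p = 2 * #|edges G|%:R.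
Proof.
rewrite (bigID (fun p : V * V => p.1 != p.2))/= [X in _ + X]big1 ?addr0; last first.
  by move=> [i j] /=; rewrite negbK => /eqP->; exact: adjacency_diag.
rewrite (sum_pairs (fun e => (e \in edges G)%:R)); congr (_ * _).
rewrite -sum1_card natr_sum big_mkcond [RHS]big_mkcond; apply: eq_bigr => e _.
by case: (boolP (e \in _)) => [/edge_card2 ->|]//; case: ifP.
Qed.

Lemma triangle_edge G A (i j : V) : A \in triangles G -> i \in A -> j \in A -> i != j ->
  [set i; j] \in edges G.
Proof.
rewrite inE => /andP[_ /forallP h] iA jA ij.
apply: (implyP (h [set i; j])); rewrite cards2 ij/=.
by apply/fintype.subsetP => x; rewrite !inE => /orP[]/eqP->.
Qed.

Lemma triangle_of_edges G (i j k : V) : [set i; j] \in edges G ->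
  [set j; k] \in edges G -> [set k; i] \in edges G -> [set i; j; k] \in triangles G.
Proof.
move=> ij jk ki; rewrite inE; apply/andP; split.
  rewrite finset.setUC cardsU1 cards2 !inE (edge_neq ij) negb_or.
  by rewrite (edge_neq ki) [k == j]eq_sym (edge_neq jk).
apply/forallP => e; apply/implyP => /andP[/cards2P[x [y [xy ->]]]].
move=> /fintype.subsetP h; have := h x; have := h y; rewrite !inE !eqxx orbT.
move=> /(_ isT) hy /(_ isT) hx.
case/orP: hx hy xy => [/orP[]|] /eqP -> /orP[/orP[]|] /eqP ->; rewrite ?eqxx//= => _;
  by rewrite // finset.setUC.
Qed.

Lemma sum_triples_card3 A : #|A| = 3%N ->
  \sum_(i in A) \sum_(j in A :\ i) \sum_(k in A :\ i :\ j) 1 = 6 :> R.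
Proof.
move=> A3; have c2 (i : V) : i \in A -> #|A :\ i| = 2%N.
  by move=> iA; have := cardsD1 i A; rewrite iA A3 => -[].
have card1 (i j : V) : i \in A -> j \in A :\ i -> #|A :\ i :\ j| = 1%N.
  by move=> iA jA; have := cardsD1 j (A :\ i); rewrite jA c2// => -[].
transitivity (\sum_(i in A) \sum_(j in A :\ i) 1 : R).
  apply: eq_bigr => i iA; apply: eq_bigr => j jA.
  by rewrite sumr_const card1.
transitivity (\sum_(i in A) 2 : R).
  by apply: eq_bigr => i iA; rewrite sumr_const c2.
by rewrite sumr_const A3; ring.
Qed.

(** Both sides count ordered triples of distinct vertices spanning a triangle;
    a triple determines its triangle. *)
Lemma triangle_sum_adjacency G : triangle_sum (adjacency G) = 6 * #|triangles G|%:R.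
Proof.
have -> : 6 * #|triangles G|%:R = \sum_(A in triangles G)
    \sum_(i in A) \sum_(j in A :\ i) \sum_(k in A :\ i :\ j) 1 :> R.
  rewrite mulrC mulr_natl -sumr_const; apply: eq_bigr => A.
  by rewrite inE => /andP[/eqP/sum_triples_card3 -> _].
rewrite /triangle_sum.
under [RHS]eq_bigr do rewrite big_mkcond.
rewrite [RHS]exchange_big; apply: eq_bigr => i _ /=; rewrite -[RHS]big_mkcondr/=.
under [RHS]eq_bigr do rewrite big_mkcond.
rewrite [RHS]exchange_big; apply: eq_bigr => j _ /=; rewrite -[RHS]big_mkcondr/=.
under [RHS]eq_bigr do rewrite big_mkcond.
rewrite [RHS]exchange_big; apply: eq_bigr => k _ /=; rewrite -[RHS]big_mkcondr/=.
rewrite /adjacency/= -!natrM !mulnb.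
case: (boolP (_ && _)) => [/andP[/andP[ij jk] ki]|nE].
  rewrite (big_pred1 [set i; j; k])// => A; apply/idP/eqP => [|->].
    rewrite !inE => /andP[/andP[/andP[/andP[/eqP A3 _] iA] /andP[ji jA]] /and3P[kj kI kA]].
    apply/esym/eqP; rewrite eqEcard A3; apply/andP; split.
      by apply/fintype.subsetP => x; rewrite !inE => /orP[/orP[]|] /eqP->.
    by rewrite finset.setUC cardsU1 cards2 !inE negb_or kj kI eq_sym ji.
  rewrite triangle_of_edges// !inE !eqxx !orbT (edge_neq ki) !andbT.
  by rewrite ![_ == i]eq_sym ![k == j]eq_sym (edge_neq ij) (edge_neq jk).
rewrite big_pred0// => A; apply/negP => /andP[/andP[/andP[At iA]]].
rewrite !inE => /andP[ji jA] /and3P[kj kI kA].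
move/negP: nE; apply; rewrite !(triangle_edge At)//; first by rewrite eq_sym.
by rewrite eq_sym.
Qed.

(** The Hamiltonian in terms of the full symmetric matrix, in which each edge
    is counted twice and each triangle six times. *)
Lemma ergm_stat_adjacency (a b : R) G : (0 < n)%N ->
  n%:R ^+ 2 * ergm_stat a b G =
  a * \sum_p adjacency G p + b / n%:R * triangle_sum (adjacency G).
Proof.
move=> n0; rewrite sum_adjacency triangle_sum_adjacency /ergm_stat.
by field; rewrite pnatr_eq0 -lt0n.
Qed.

(** Independence of edges: choosing a graph amounts to choosing, for each 2-set,
    whether it is an edge. *)
Lemma sum_graph_prod (w : {set V} -> bool -> R) :
  \sum_G \prod_(e : {set V} | #|e| == 2%N) w e (e \in edges G) =
  \prod_(e : {set V} | #|e| == 2%N) (w e true + w e false).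
Proof.
(* Sets of size other than 2 get weight 0 when chosen and 1 when omitted, so
   that the sum over all families of sets reduces to graphs. *)
pose F e := if #|e| == 2%N then w e true else 0.
pose H e := if #|e| == 2%N then w e false else 1.
have -> : \prod_(e : {set V} | #|e| == 2%N) (w e true + w e false) = \prod_e (F e + H e).
  by rewrite big_mkcond; apply: eq_bigr => e _; rewrite /F /H; case: ifP => //; rewrite add0r.
rewrite bigA_distr (bigID (fun E : {set {set V}} => [forall e in E, #|e| == 2%N]))/=.
rewrite [X in _ + X]big1 ?addr0; last first.
  by move=> E /forall_inPn[e eE ne]; rewrite (bigD1 e)//= eE /F (negPf ne) mul0r.
rewrite [RHS](reindex_omap (val : simple_graph n -> _) insub)/=; last first.
  by move=> E PE; rewrite insubT.
apply: eq_big => [G|G _]; first by rewrite (valP G) valK eqxx.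
rewrite big_mkcond; apply: eq_bigr => e _; rewrite /F /H -/(edges G).
case: (boolP (e \in edges G)) => [/edge_card2 ->|_]//.
Qed.
End graph_sums.

(** * Upper bound on the partition function *)

Section block_model.
Variables (R : realType) (n : nat).
Implicit Types (G : simple_graph n) (P : 'I_n -> nat) (B : 'I_n * 'I_n -> R).
Local Notation V := 'I_n.

Definition block_density P G : V * V -> R := average (block P) (adjacency R G).

Lemma block_density_itv P G p : 0 <= block_density P G p <= 1.
Proof.
rewrite /block_density average_ge0 ?average_le1// => q;
  by case/andP: (adjacency_itv R G q).
Qed.

Lemma block_density_sym P G i j : block_density P G (i, j) = block_density P G (j, i).
Proof.
apply: (@average_involution R _ _ (block P) (adjacency R G) (fun p => (p.2, p.1)) (j, i)).
- by case.
- by move=> [x y]; exact: adjacency_sym.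
- by move=> [x y] [x' y']; rewrite /block/= !xpair_eqE andbC.
Qed.

(** The value of a symmetric function of two vertices at an unordered pair. *)
Definition edge_value B (e : {set V}) : R :=
  (\sum_(p | (p.1 != p.2) && ([set p.1; p.2] == e)) B p) / 2.

Lemma edge_value_set2 B i j : (forall i j, B (i, j) = B (j, i)) -> i != j ->
  edge_value B [set i; j] = B (i, j).
Proof.
by move=> Bsym ij; rewrite /edge_value sum_pairs_edge// (Bsym j); field.
Qed.

Lemma edge_value_itv B (e : {set V}) : (forall i j, B (i, j) = B (j, i)) ->
  (forall p, 0 <= B p <= 1) -> #|e| == 2%N -> 0 <= edge_value B e <= 1.
Proof. by move=> Bsym B01 /cards2P[x [y [xy ->]]]; rewrite edge_value_set2. Qed.

(** Probability of [G] when the edges are independent with probabilities [B]. *)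
Definition block_model B G : R :=
  \prod_(e : {set V} | #|e| == 2%N)
    (if e \in edges G then edge_value B e else 1 - edge_value B e).

Lemma block_model_sum1 B : \sum_G block_model B G = 1.
Proof.
rewrite (sum_graph_prod (fun e b => if b then edge_value B e else 1 - edge_value B e)).
by rewrite big1// => e _; rewrite addrC subrK.
Qed.

Lemma block_model_ge0 B G : (forall i j, B (i, j) = B (j, i)) ->
  (forall p, 0 <= B p <= 1) -> 0 <= block_model B G.
Proof.
move=> Bsym B01; apply: prodr_ge0 => e /(edge_value_itv Bsym B01)/andP[e0 e1].
by case: ifP => _; rewrite ?subr_ge0.
Qed.

Lemma prod_expR_ln (I : finType) (Q : pred I) (F : I -> R) :
  (forall i, Q i -> 0 < F i) -> \prod_(i | Q i) F i = expR (\sum_(i | Q i) ln (F i)).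
Proof.
move=> F0; rewrite (big_morph expR (@expRD R) (@expR0 R)).
by apply: eq_bigr => i /F0 Fi; rewrite lnK.
Qed.

(** Maximum likelihood: on each block [B] is the empirical edge frequency of [G],
    so the log-likelihood of [G] is minus the empirical entropy.  The sum over
    ordered pairs counts each edge twice, whence the factor [1/2]; the diagonal
    entries of [A] vanish and contribute [ln (1 - B) <= 0] to it. *)
Lemma block_model_ge P G :
  expR (- \sum_p entropy (block_density P G p) / 2) <= block_model (block_density P G) G.
Proof.
set B := block_density P G.
have Bsym := block_density_sym P G.
have B01 := block_density_itv P G.
pose w (e : {set V}) : R := if e \in edges G then edge_value B e else 1 - edge_value B e.
have w0 (e : {set V}) : #|e| == 2%N -> 0 < w e.
  move=> /cards2P[x [y [xy ->]]]; rewrite /w edge_value_set2//.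
  have a01 q := adjacency_itv R G q.
  case: (boolP (_ \in _)) => xyG.
    apply: average_gt0 => [q|]; first by case/andP: (a01 q).
    by rewrite /adjacency xyG.
  rewrite subr_gt0; apply: average_lt1 => [q|]; first by case/andP: (a01 q).
  by rewrite /adjacency (negPf xyG).
rewrite /block_model -/(w _) (prod_expR_ln w0) ler_expR.
pose ll p := adjacency R G p * ln (B p) + (1 - adjacency R G p) * ln (1 - B p).
have -> : \sum_(e : {set V} | #|e| == 2%N) ln (w e) = (\sum_(p | p.1 != p.2) ll p) / 2.
  have := sum_pairs (fun e => ln (w e)).
  have -> : \sum_(p : V * V | p.1 != p.2) ln (w [set p.1; p.2]) = \sum_(p | p.1 != p.2) ll p.
    apply: eq_bigr => -[i j] /= ij; rewrite /w edge_value_set2// /ll /adjacency/=.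
    by case: (_ \in _); rewrite ?subrr ?subr0 ?mul0r ?mul1r ?addr0 ?add0r.
  by move=> ->; field.
have -> : - \sum_p entropy (B p) / 2 = (\sum_p ll p) / 2.
  rewrite -mulr_suml -mulNr; congr (_ / _); rewrite -sumrN.
  transitivity (\sum_p (B p * ln (B p) + (1 - B p) * ln (1 - B p))).
    by apply: eq_bigr => p _; rewrite /entropy opprK.
  rewrite !big_split/=; congr (_ + _).
    rewrite sum_averageM// => x y xy; congr ln; exact: eq_average.
  under eq_bigr do rewrite -average_compl.
  rewrite sum_averageM; last by move=> x y xy; congr ln; exact: eq_average.
  by apply: eq_bigr => p _; rewrite average_compl.
rewrite ler_wpM2r// [leLHS](bigID (fun p : V * V => p.1 != p.2))/= gerDl.
apply: sumr_le0 => -[i j] /=; rewrite negbK => /eqP ->.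
rewrite /ll adjacency_diag mul0r add0r subr0 mul1r ln_le0// lerBlDr lerDl.
by case/andP: (B01 (j, j)).
Qed.

Definition gibbs_weight a b G : R := expR (n%:R ^+ 2 * ergm_stat a b G).

Definition quasirandom (eps : R) P G :=
  cut_bounded (fun p => adjacency R G p - block_density P G p) (eps * #|{: V * V}|%:R).

(** Block averages preserve the number of edges; quasirandomness and the cubic
    inequality bound the triangle term by [b (sum B^3)] up to [3 b eps n^2].
    The entropy terms of [free_energy] come from the likelihood of [G]. *)
Lemma weight_le_block_model (a b L eps : R) P G : (0 < n)%N -> 0 <= b ->
  (forall u, 0 <= u <= 1 -> free_energy a b u <= L) -> quasirandom eps P G ->
  gibbs_weight a b G <=
  expR (n%:R ^+ 2 * (L + 3 * b * eps)) * block_model (block_density P G) G.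
Proof.
move=> n0 b0 lL qr; apply: le_trans (_ : _ <= expR (n%:R ^+ 2 * (L + 3 * b * eps)) *
  expR (- \sum_p entropy (block_density P G p) / 2)) _; last first.
  by rewrite ler_pM2l ?expR_gt0// block_model_ge.
rewrite -expRD ler_expR ergm_stat_adjacency//.
set B := block_density P G.
have nn0 : 0 < n%:R :> R by rewrite ltr0n.
have B01 p : 0 <= B p <= 1 by exact: block_density_itv.
have sB : \sum_p adjacency R G p = \sum_p B p by rewrite sum_average.
have t1 := triangle_sum_cut qr (adjacency_itv R G) B01.
have t2 : triangle_sum B <= #|V|%:R * \sum_p B p ^+ 3.
  by apply: triangle_sum_le_cube => p; case/andP: (B01 p).
have tb : b / n%:R * triangle_sum (adjacency R G) <=
    b * \sum_p B p ^+ 3 + 3 * b * eps * n%:R ^+ 2.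
  have -> : b * \sum_p B p ^+ 3 + 3 * b * eps * n%:R ^+ 2 =
    b / n%:R * (n%:R * \sum_p B p ^+ 3 + 3 * n%:R * (eps * (n%:R * n%:R))).
    by field; rewrite gt_eqF.
  rewrite ler_wpM2l ?divr_ge0//.
  by move: t1 t2; rewrite card_prod card_ord natrM; lra.
have sL : \sum_p free_energy a b (B p) <= n%:R ^+ 2 * L.
  apply: (@le_trans _ _ (\sum_(p : V * V) L)); first by apply: ler_sum => p _; exact: lL.
  by rewrite sumr_const card_prod card_ord -[leLHS]mulr_natl natrM expr2.
move: sL; rewrite /free_energy !big_split/= -!mulr_sumr sB; lra.
Qed.

Section union_bound.
Variables (K : nat) (a b L eps : R).
Hypotheses (n0 : (0 < n)%N) (b0 : 0 <= b)
  (lL : forall u, 0 <= u <= 1 -> free_energy a b u <= L).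
Implicit Type Q : {ffun V -> 'I_K}.

(** Partitions range over a finite type for the union bound, whereas regularity
    produces colours in [nat]. *)
Definition colouring Q (v : V) : nat := Q v.

Definition block_count Q G : {ffun 'I_K * 'I_K -> 'I_(n * n).+1} :=
  [ffun c => inord #|[pred p : V * V | ((Q p.1, Q p.2) == c) && ([set p.1; p.2] \in edges G)]|].

Lemma eq_block_density Q G G' : block_count Q G = block_count Q G' ->
  block_density (colouring Q) G = block_density (colouring Q) G'.
Proof.
move=> /ffunP h; apply/funext => p; rewrite /block_density /average; congr (_ / _).
have e H : \sum_(q | block (colouring Q) q == block (colouring Q) p) adjacency R H q =
    (block_count Q H (Q p.1, Q p.2))%:R.
  rewrite ffunE inordK; last first.
    by rewrite ltnS (leq_trans (max_card _))// card_prod card_ord.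
  rewrite -sum1_card natr_sum big_mkcond [RHS]big_mkcond; apply: eq_bigr => q _.
  rewrite !inE /adjacency /block !xpair_eqE /colouring !(inj_eq val_inj).
  by case: ifP => // _; case: (_ \in _).
by rewrite !e h.
Qed.

(** Graphs with the same block counts share their block model, so their weights
    are bounded by multiples of a single probability distribution. *)
Lemma class_weight_le Q (s : {ffun 'I_K * 'I_K -> 'I_(n * n).+1}) :
  \sum_(G | `[< quasirandom eps (colouring Q) G >] && (block_count Q G == s)) gibbs_weight a b G
  <= expR (n%:R ^+ 2 * (L + 3 * b * eps)).
Proof.
case: (pickP (fun G => `[< quasirandom eps (colouring Q) G >] && (block_count Q G == s)))
  => [G0 /andP[_ /eqP s0]|none]; last by rewrite big_pred0// expR_ge0.
pose q G := block_model (block_density (colouring Q) G0) G.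
have q0 G : 0 <= q G.
  by apply: block_model_ge0; [exact: block_density_sym|exact: block_density_itv].
apply: (@le_trans _ _ (\sum_G expR (n%:R ^+ 2 * (L + 3 * b * eps)) * q G)); last first.
  by rewrite -mulr_sumr block_model_sum1 mulr1.
rewrite big_mkcond; apply: ler_sum => G _; case: ifP => [/andP[/asboolP qr /eqP sG]|_].
  rewrite /q -(@eq_block_density Q G G0) ?sG//; exact: weight_le_block_model.
by rewrite mulr_ge0 ?expR_ge0.
Qed.

(** There are [K^n] partitions and at most [(n^2 + 1)^(K^2)] tables of block
    counts, both negligible against [exp (n^2)]. *)
Lemma sum_weight_le : (forall G, exists Q, quasirandom eps (colouring Q) G) ->
  \sum_G gibbs_weight a b G <=
  K%:R ^+ n * (n%:R ^+ 2 + 1) ^+ (K * K) * expR (n%:R ^+ 2 * (L + 3 * b * eps)).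
Proof.
move=> hQ.
apply: (@le_trans _ _ (\sum_Q \sum_s
  \sum_(G | `[< quasirandom eps (colouring Q) G >] && (block_count Q G == s))
    gibbs_weight a b G)).
  apply: (@le_trans _ _
    (\sum_Q \sum_(G | `[< quasirandom eps (colouring Q) G >]) gibbs_weight a b G)).
    rewrite (exchange_big_dep predT)//=; apply: ler_sum => G _.
    have [Q qr] := hQ G; rewrite (bigD1 Q)/=; last exact/asboolP.
    by rewrite lerDl sumr_ge0// => ? _; exact: expR_ge0.
  by apply: ler_sum => Q _; rewrite (partition_big (block_count Q) predT).
apply: (@le_trans _ _ (\sum_Q \sum_(s : {ffun 'I_K * 'I_K -> 'I_(n * n).+1})
    expR (n%:R ^+ 2 * (L + 3 * b * eps)))).
  by apply: ler_sum => Q _; apply: ler_sum => s _; exact: class_weight_le.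
rewrite sumr_const sumr_const !card_ffun card_prod !card_ord.
by rewrite -mulrnA -[leLHS]mulr_natl mulnC natrM !natrX -natr1 natrM expr2.
Qed.
End union_bound.

End block_model.

Lemma partition_function_le (R : realType) (a b L eps : R) : 0 <= b -> 0 < eps ->
  (forall u, 0 <= u <= 1 -> free_energy a b u <= L) ->
  exists K : nat, forall n, (0 < n)%N ->
  \sum_(G : simple_graph n) gibbs_weight a b G <=
  K%:R ^+ n * (n%:R ^+ 2 + 1) ^+ (K * K) * expR (n%:R ^+ 2 * (L + eps)).
Proof.
move=> b0 eps0 lL.
pose d := eps / (3 * b + 1).
have d0 : 0 < d by rewrite divr_gt0//; lra.
pose m := Num.bound (d ^+ 2)^-1.
have md : 1 < m%:R * d ^+ 2.
  by rewrite -ltr_pdivrMr ?exprn_gt0// div1r archi_boundP// invr_ge0 exprn_ge0// ltW.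
exists (4 ^ m)%N => n n0.
have hQ (G : simple_graph n) : exists Q : {ffun 'I_n -> 'I_(4 ^ m)}, quasirandom d (colouring Q) G.
  have [||P Pm cut] := @weak_regularity R _ (adjacency R G) d m _ _ md (adjacency_itv R G).
  - by rewrite card_ord.
  - exact: ltW.
  exists [ffun v => Ordinal (Pm v)].
  have -> // : colouring [ffun v => Ordinal (Pm v)] = P.
  by apply/funext => v; rewrite /colouring ffunE.
apply: le_trans (sum_weight_le n0 b0 lL hQ) _.
rewrite ler_wpM2l ?mulr_ge0 ?exprn_ge0 ?addr_ge0//.
rewrite ler_expR ler_wpM2l ?exprn_ge0// lerD2l /d.
by rewrite mulrCA ger_pMr// ler_pdivrMr; lra.
Qed.

(** * Lower bound on the partition function *)

Section lower_bound.
Variables (R : realType) (n : nat).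
Implicit Types (G : simple_graph n) (a b u : R).
Local Notation V := 'I_n.

Lemma natr_bin2 m : 2 * 'C(m, 2)%:R = m%:R * (m%:R - 1) :> R.
Proof.
have := bin_ffact m 2; case: m => [|k]; first by rewrite bin0n mulr0 mul0r.
rewrite !ffactnS ffactn0 muln1 /= => /(congr1 (GRing.natmul (1 : R))).
by rewrite !natrM -[k.+1%:R]natr1 addrK => <-; rewrite mulrC.
Qed.

Lemma natr_bin3 m : 6 * 'C(m, 3)%:R = m%:R * (m%:R - 1) * (m%:R - 2) :> R.
Proof.
have := bin_ffact m 3; case: m => [|[|k]].
- by rewrite bin0n mulr0 !mul0r.
- by rewrite bin_small// mulr0 subrr mulr0 mul0r.
rewrite !ffactnS ffactn0 muln1 /= => /(congr1 (GRing.natmul (1 : R))).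
by rewrite !natrM -[k.+2%:R]natr1 -[k.+1%:R]natr1 => h; rewrite mulrC h; ring.
Qed.

(** The Erdos-Renyi measure of edge probability [u]. *)
Definition er_prob u G : R :=
  \prod_(e : {set V} | #|e| == 2%N) (if e \in edges G then u else 1 - u).

Lemma er_prob_sum1 u : \sum_G er_prob u G = 1.
Proof.
rewrite (sum_graph_prod (fun _ (b : bool) => if b then u else 1 - u)).
by rewrite big1// => e _; rewrite addrC subrK.
Qed.

Lemma er_prob_gt0 u G : 0 < u < 1 -> 0 < er_prob u G.
Proof.
by move=> /andP[u0 u1]; apply: prodr_gt0 => e _; case: ifP; rewrite ?subr_gt0.
Qed.

Lemma er_prob_contains u (D : {set {set V}}) : (forall e, e \in D -> #|e| = 2%N) ->
  \sum_G er_prob u G * (D \subset edges G)%:R = u ^+ #|D|.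
Proof.
move=> D2.
pose w (e : {set V}) (b : bool) : R :=
  if e \in D then (if b then u else 0) else (if b then u else 1 - u).
transitivity (\sum_G \prod_(e : {set V} | #|e| == 2%N) w e (e \in edges G)).
  apply: eq_bigr => G _; case: (boolP (D \subset _)) => [/fintype.subsetP DG|/subsetPn[e eD eG]].
    rewrite mulr1; apply: eq_bigr => e _; rewrite /w.
    by case: (boolP (e \in D)) => // /DG ->.
  by rewrite mulr0 (bigD1 e) /=; [rewrite /w eD (negPf eG) mul0r|rewrite D2].
rewrite sum_graph_prod (bigID (fun e => e \in D))/= [X in _ * X]big1 ?mulr1; last first.
  by move=> e /andP[_ eD]; rewrite /w (negPf eD) addrC subrK.
rewrite (eq_big (fun e => e \in D) (fun=> u)) ?prodr_const//.
  by move=> e; case: (boolP (e \in D)) => [/D2 ->|]; rewrite ?andbF.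
by move=> e /andP[_ eD]; rewrite /w eD addr0.
Qed.

Lemma er_mean_edges u : \sum_G er_prob u G * #|edges G|%:R = 'C(n, 2)%:R * u.
Proof.
transitivity (\sum_G \sum_(e : {set V} | #|e| == 2%N) er_prob u G * ([set e] \subset edges G)%:R).
  apply: eq_bigr => G _; rewrite -mulr_sumr; congr (_ * _).
  rewrite -sum1_card natr_sum big_mkcond [RHS]big_mkcond; apply: eq_bigr => e _.
  by rewrite finset.sub1set; case: (boolP (e \in _)) => [/edge_card2 ->|_]//; case: ifP.
rewrite exchange_big/= (eq_bigr (fun=> u)) => [|e /eqP e2]; last first.
  by rewrite er_prob_contains ?cards1// => e'; rewrite finset.in_set1 => /eqP ->.
rewrite sumr_const mulr_natl; congr (_ *+ _).
by rewrite -[n in RHS]card_ord -card_draws; apply: eq_card => e; rewrite !inE.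
Qed.

Lemma er_mean_triangles u : \sum_G er_prob u G * #|triangles G|%:R = 'C(n, 3)%:R * u ^+ 3.
Proof.
pose D (A : {set V}) := [set e : {set V} | (e \subset A) && (#|e| == 2%N)].
transitivity (\sum_G \sum_(A : {set V} | #|A| == 3%N) er_prob u G * (D A \subset edges G)%:R).
  apply: eq_bigr => G _; rewrite -mulr_sumr; congr (_ * _).
  rewrite -sum1_card natr_sum big_mkcond [RHS]big_mkcond; apply: eq_bigr => A _.
  have -> : (A \in triangles G) = (#|A| == 3%N) && (D A \subset edges G).
    rewrite inE; congr (_ && _).
    apply/forallP/fintype.subsetP => [h e|h e]; first by rewrite inE andbC => /(implyP (h e)).
    by apply/implyP => he; apply: h; rewrite inE andbC.
  by case: (_ == _); case: (_ \subset _).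
rewrite exchange_big/= (eq_bigr (fun=> u ^+ 3)) => [|A /eqP A3]; last first.
  rewrite er_prob_contains; first by rewrite cards_draws A3.
  by move=> e; rewrite inE => /andP[_ /eqP].
rewrite sumr_const mulr_natl; congr (_ *+ _).
by rewrite -[n in RHS]card_ord -card_draws; apply: eq_card => e; rewrite !inE.
Qed.

Lemma ln_er_prob u G : 0 < u < 1 ->
  ln (er_prob u G) = #|edges G|%:R * (ln u - ln (1 - u)) + 'C(n, 2)%:R * ln (1 - u).
Proof.
move=> /andP[u0 u1]; rewrite /er_prob prod_expR_ln ?expRK; last first.
  by move=> e _; case: ifP; rewrite ?subr_gt0.
transitivity (\sum_(e : {set V} | #|e| == 2%N)
    ((e \in edges G)%:R * (ln u - ln (1 - u)) + ln (1 - u))).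
  by apply: eq_bigr => e _; case: ifP => _; rewrite ?mul1r ?subrK ?mul0r ?add0r.
rewrite big_split/= -mulr_suml sumr_const; congr (_ * _ + _).
  rewrite -sum1_card natr_sum big_mkcond [RHS]big_mkcond; apply: eq_bigr => e _.
  by case: (boolP (e \in _)) => [/edge_card2 ->|_]//; case: ifP.
rewrite mulr_natl; congr (_ *+ _).
by rewrite -[n in RHS]card_ord -card_draws; apply: eq_card => e; rewrite !inE.
Qed.

(** Jensen's inequality for [exp], from its tangent line at the mean. *)
Lemma gibbs_jensen (I : finType) (p X : I -> R) : (forall i, 0 <= p i) ->
  \sum_i p i = 1 -> expR (\sum_i p i * X i) <= \sum_i p i * expR (X i).
Proof.
move=> p0 p1; set m := \sum_i p i * X i.
have -> : expR m = \sum_i p i * (expR m * (1 + (X i - m))).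
  transitivity (expR m * (\sum_i p i * X i + (1 - m) * \sum_i p i)).
    by rewrite p1 -/m; ring.
  by rewrite mulrDr !mulr_sumr -big_split/=; apply: eq_bigr => i _; ring.
apply: ler_sum => i _; rewrite ler_wpM2l//.
rewrite -[X in _ <= expR X](subrK m (X i)) expRD mulrC ler_wpM2r ?expR_ge0//.
exact: expR_ge1Dx.
Qed.

Lemma weightE a b G : (0 < n)%N ->
  gibbs_weight a b G = expR (2 * a * #|edges G|%:R + 6 * b / n%:R * #|triangles G|%:R).
Proof.
move=> n0; rewrite /(gibbs_weight _ _ _) /ergm_stat; congr expR.
by field; rewrite pnatr_eq0 -lt0n.
Qed.

(** Gibbs' variational principle with the Erdos-Renyi measure as trial measure.
    Replacing [n (n - 1)] and [(n - 1) (n - 2)] by [n^2] costs only [O(n)]. *)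
Lemma partition_function_ge a b u : (0 < n)%N -> 0 <= b -> 0 < u < 1 ->
  expR (n%:R ^+ 2 * free_energy a b u - n%:R * (`|a| + 1 / 2 + 3 * b)) <=
  \sum_(G : simple_graph n) gibbs_weight a b G.
Proof.
move=> n0 b0 u01; have /andP[u0 u1] := u01.
pose X G := 2 * a * #|edges G|%:R + 6 * b / n%:R * #|triangles G|%:R - ln (er_prob u G).
have -> : \sum_(G : simple_graph n) gibbs_weight a b G = \sum_G er_prob u G * expR (X G).
  apply: eq_bigr => G _; rewrite weightE// /X expRB lnK ?posrE ?er_prob_gt0//.
  by rewrite [RHS]mulrC divfK// gt_eqF// er_prob_gt0.
apply: le_trans (gibbs_jensen X (fun G => ltW (er_prob_gt0 G u01)) (er_prob_sum1 u)).
rewrite ler_expR.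
have -> : \sum_G er_prob u G * X G =
  (2 * a - (ln u - ln (1 - u))) * ('C(n, 2)%:R * u) +
  6 * b / n%:R * ('C(n, 3)%:R * u ^+ 3) - 'C(n, 2)%:R * ln (1 - u).
  rewrite -er_mean_edges -er_mean_triangles.
  transitivity ((2 * a - (ln u - ln (1 - u))) * (\sum_G er_prob u G * #|edges G|%:R) +
    6 * b / n%:R * (\sum_G er_prob u G * #|triangles G|%:R) -
    (\sum_G er_prob u G) * ('C(n, 2)%:R * ln (1 - u))); last by rewrite er_prob_sum1 mul1r.
  rewrite mulr_suml !mulr_sumr -!big_split -sumrB/=.
  by apply: eq_bigr => G _; rewrite /X ln_er_prob//; ring.
have nn0 : 0 < n%:R :> R by rewrite ltr0n.
have n1 : 1 <= n%:R :> R by rewrite ler1n.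
have -> : 6 * b / n%:R * ('C(n, 3)%:R * u ^+ 3) = b * u ^+ 3 * ((n%:R - 1) * (n%:R - 2)).
  transitivity (b / n%:R * u ^+ 3 * (6 * 'C(n, 3)%:R)); first by ring.
  by rewrite natr_bin3; field; rewrite gt_eqF.
have -> : (2 * a - (ln u - ln (1 - u))) * ('C(n, 2)%:R * u) +
    b * u ^+ 3 * ((n%:R - 1) * (n%:R - 2)) - 'C(n, 2)%:R * ln (1 - u) =
  2 * 'C(n, 2)%:R * (a * u + entropy u / 2) + b * u ^+ 3 * ((n%:R - 1) * (n%:R - 2)).
  by rewrite /entropy; field.
rewrite natr_bin2 /free_energy.
have hu : entropy u <= 1 by apply: entropy_le1; rewrite !ltW.
have au : a * u <= `|a|.
  apply: le_trans (ler_norm _) _; rewrite normrM ler_piMr// ger0_norm ?ltW//.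
have bu : b * u ^+ 3 <= b by rewrite ler_piMr// exprn_ile1 ?ltW.
have bu0 : 0 <= b * u ^+ 3 by rewrite mulr_ge0// exprn_ge0// ltW.
have : n%:R * (a * u + entropy u / 2 + 3 * (b * u ^+ 3)) <= n%:R * (`|a| + 1 / 2 + 3 * b).
  by rewrite ler_pM2l//; lra.
move: (entropy u) (b * u ^+ 3) bu0 => H B B0; lra.
Qed.
End lower_bound.

(** * Concentration of the edge density by tilting *)

Section edge_density_deviation.
Local Open Scope classical_set_scope.
Local Open Scope ring_scope.
Variable R : realType.
Implicit Types a b c eta : R.

Lemma cvg0_le_geometric (u : nat -> R) (C r : R) : 0 <= r < 1 ->
  (forall n, (0 < n)%N -> 0 <= u n <= C * r ^+ n) -> u @ \oo --> (0 : R).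
Proof.
move=> /andP[r0 r1] h.
apply: (@squeeze_cvgr _ _ _ _ (fun=> 0) (geometric C r)).
- by near=> n; apply: h; near: n; exact: nbhs_infty_gt.
- exact: cvg_cst.
- by apply: cvg_geometric; rewrite ger0_norm.
Unshelve. all: by end_near. Qed.

Lemma ergm_prob_weight a b n (A : pred (simple_graph n)) : (0 < n)%N ->
  ergm_prob a b A =
  (\sum_(G | A G) gibbs_weight a b G) / \sum_(G : simple_graph n) gibbs_weight a b G.
Proof.
move=> n0; rewrite /ergm_prob mulr_suml; apply: eq_bigr => G _.
have Z0 : 0 < \sum_(G : simple_graph n) gibbs_weight a b G.
  by rewrite (bigD1 G)//= ltr_pwDl ?expR_gt0// sumr_ge0// => H _; exact: expR_ge0.
rewrite /ergm_pmf mulrBr /ergm_psi mulrA divff ?mul1r; last first.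
  by rewrite expf_neq0// pnatr_eq0 -lt0n.
by rewrite expRB lnK ?posrE.
Qed.

Lemma edges_le_bin n (G : simple_graph n) : (#|edges G| <= 'C(n, 2))%N.
Proof.
rewrite -[n in 'C(n, 2)]card_ord -card_draws; apply: subset_leq_card.
by apply/fintype.subsetP => e /edge_card2; rewrite inE => ->.
Qed.

Lemma edge_density_gt n (G : simple_graph n) c : c < edge_density R G ->
  c * 'C(n, 2)%:R <= #|edges G|%:R.
Proof.
rewrite /edge_density; have [->|N0] := posnP 'C(n, 2); first by rewrite mulr0.
by rewrite ltr_pdivlMr ?ltr0n// => /ltW.
Qed.

Lemma edge_density_lt n (G : simple_graph n) c : edge_density R G < c ->
  #|edges G|%:R <= c * 'C(n, 2)%:R.
Proof.
rewrite /edge_density; have := edges_le_bin G.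
have [->|N0 _] := posnP 'C(n, 2); first by rewrite mulr0 leqn0 => /eqP ->.
by rewrite ltr_pdivrMr ?ltr0n// => /ltW.
Qed.

Lemma weight_tilt a b eta n (G : simple_graph n) : (0 < n)%N ->
  gibbs_weight (a + eta) b G = expR (2 * eta * #|edges G|%:R) * gibbs_weight a b G.
Proof. by move=> n0; rewrite !weightE// -expRD; congr expR; ring. Qed.

Lemma poly_le_expR (K n : nat) :
  K%:R ^+ n * (n%:R ^+ 2 + 1) ^+ (K * K) <= expR ((K + 2 * (K * K))%:R * n%:R) :> R.
Proof.
have le_exp (x : R) : x <= expR x by have := expR_ge1Dx x; lra.
rewrite natrD mulrDl expRD ler_pM ?exprn_ge0 ?addr_ge0//.
  by rewrite expRM_natr lerXn2r ?nnegrE ?expR_ge0.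
rewrite natrM mulrAC expRM_natr lerXn2r ?nnegrE ?addr_ge0 ?exprn_ge0 ?expR_ge0//.
apply: (@le_trans _ _ ((1 + n%:R) ^+ 2)).
  by have : 0 <= n%:R :> R by []; lra.
rewrite expRM_natl lerXn2r ?nnegrE ?expR_ge0 ?addr_ge0//.
exact: expR_ge1Dx.
Qed.

(** Exponential Markov inequality in the number of edges: on the event the
    tilted weight is at least [exp (eta c n (n - 1))] times the original one, so
    the probability is at most the ratio of the tilted and untilted partition
    functions divided by that factor. *)
Lemma ergm_prob_tilted_cvg0 a b eta c (A : forall n, pred (simple_graph n)) :
  0 <= b -> separates a b eta c ->
  (forall n (G : simple_graph n), A n G -> eta * (c * 'C(n, 2)%:R) <= eta * #|edges G|%:R) ->
  (fun n => ergm_prob a b (A n)) @ \oo --> (0 : R).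
Proof.
move=> b0 [u [L [u01 lL Lu]]] hA.
pose d := (free_energy a b u + eta * c - L) / 2.
have d0 : 0 < d by rewrite /d; lra.
have [K hK] := partition_function_le b0 d0 lL.
pose D := (K + 2 * (K * K))%:R + (`|a| + 1 / 2 + 3 * b) + eta * c.
apply: (@cvg0_le_geometric _ (expR (D ^+ 2 / (2 * d))) (expR (- (d / 2)))).
  by rewrite expR_ge0/= expR_lt1; lra.
move=> n n0; rewrite ergm_prob_weight//.
set Z := \sum_(G : simple_graph n) gibbs_weight a b G.
have Zge := partition_function_ge a n0 b0 u01; rewrite -/Z in Zge.
have Z0 : 0 < Z := lt_le_trans (expR_gt0 _) Zge.
apply/andP; split.
  by rewrite divr_ge0 ?(ltW Z0)// sumr_ge0// => G _; exact: expR_ge0.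
rewrite ler_pdivrMr//.
apply: (@le_trans _ _ (expR (- (eta * (c * (2 * 'C(n, 2)%:R)))) *
    \sum_(G : simple_graph n) gibbs_weight (a + eta) b G)).
  rewrite mulr_sumr big_mkcond; apply: ler_sum => G _; case: ifP => [AG|_]; last first.
    by rewrite mulr_ge0 ?expR_ge0.
  rewrite weight_tilt// mulrA -expRD ler_peMl ?expR_ge0//.
  rewrite -[leLHS]expR0 ler_expR; have := hA _ _ AG; lra.
rewrite natr_bin2.
have E0 := expR_ge0 (- (eta * (c * (n%:R * (n%:R - 1))))).
apply: le_trans (ler_wpM2l E0 (hK n n0)) _.
apply: (@le_trans _ _ (expR (- (eta * (c * (n%:R * (n%:R - 1))))) *
  (expR ((K + 2 * (K * K))%:R * n%:R) * expR (n%:R ^+ 2 * (L + d))))).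
  by rewrite ler_wpM2l// ler_wpM2r ?expR_ge0// poly_le_expR.
apply: le_trans (ler_wpM2l _ Zge); last by rewrite mulr_ge0 ?exprn_ge0 ?expR_ge0.
rewrite -expRM_natr -!expRD ler_expR.
have n1 : 1 <= n%:R :> R by rewrite ler1n.
(* The exponent is at most [D n - d n^2], and completing the square turns it
   into a constant minus [d / 2 * n]. *)
have sq : 0 <= (d * n%:R - D) ^+ 2 / (2 * d).
  by rewrite divr_ge0 ?sqr_ge0// mulr_ge0 ?ltW.
have e : (d * n%:R - D) ^+ 2 / (2 * d) = d / 2 * n%:R ^+ 2 - D * n%:R + D ^+ 2 / (2 * d).
  by field; rewrite gt_eqF.
have dn : d / 2 * n%:R <= d / 2 * n%:R ^+ 2.
  by rewrite ler_wpM2l ?ler_eXnr// divr_ge0// ltW.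
rewrite e in sq.
have -> : L = free_energy a b u + eta * c - 2 * d by rewrite /d; field.
move: sq dn; rewrite {1}/D.
move: (D ^+ 2 / (2 * d)) => Q; lra.
Qed.
End edge_density_deviation.

(** * Deleting edges when the triangle parameter is nonpositive *)

Section edge_deletion.
Local Open Scope ring_scope.
Variables (R : realType) (n : nat).
Implicit Types (G : simple_graph n) (e : {set 'I_n}) (W : simple_graph n -> R).

Lemma del_edge_subproof G e : [forall f in edges G :\ e, #|f| == 2%N].
Proof. by apply/forall_inP => f; rewrite !inE => /andP[_ /edge_card2 ->]. Qed.

Definition del_edge e G : simple_graph n := Sub (edges G :\ e) (del_edge_subproof G e).

Lemma edges_del_edge e G : edges (del_edge e G) = edges G :\ e.
Proof. by []. Qed.

Lemma del_edge_inj e : {in [pred G | e \in edges G] &, injective (del_edge e)}.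
Proof.
move=> G H; rewrite !inE => eG eH /(congr1 (@edges n)); rewrite !edges_del_edge => h.
apply: val_inj; rewrite -/(edges G) -/(edges H).
by rewrite -(finset.setD1K eG) -(finset.setD1K eH) h.
Qed.

(** Deleting [e] is an injection from graphs with [e] to graphs without [e]. *)
Lemma sum_with_edge_le W (r : R) e : (forall G, 0 <= W G) ->
  (forall G, e \in edges G -> W G <= r * W (del_edge e G)) -> 0 <= r ->
  \sum_(G | e \in edges G) W G <= r * \sum_(G | e \notin edges G) W G.
Proof.
move=> W0 hW r0.
apply: (@le_trans _ _ (r * \sum_(G | e \in edges G) W (del_edge e G))).
  by rewrite mulr_sumr; exact: ler_sum.
rewrite ler_wpM2l//.
rewrite -(big_imset W (@del_edge_inj e)) big_mkcond [leRHS]big_mkcond /=.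
apply: ler_sum => H _; case: ifP => [/imsetP[G _ ->]|_]; last by case: ifP.
by rewrite edges_del_edge !inE eqxx.
Qed.

(** If a graph weighs at most [r] times what it weighs without one of its edges,
    then every edge is present with conditional probability at most
    [r / (1 + r)], and the number of edges in [s] has exponential moments no
    larger than those of a binomial variable of that parameter.  The edges are treated
    one at a time, the factors of the earlier ones being put into the weight. *)
Lemma sum_tilt_count_le W (r x : R) (s : seq {set 'I_n}) : uniq s -> 1 <= x -> 0 <= r ->
  (forall G, 0 <= W G) ->
  (forall G e, e \in edges G -> W G <= r * W (del_edge e G)) ->
  \sum_G x ^+ count (fun e => e \in edges G) s * W G <=
  ((1 + x * r) / (1 + r)) ^+ size s * \sum_G W G.
Proof.
move=> us x1 r0 W0 hW; have r1 : 0 < 1 + r by lra.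
elim: s us => [_|e s IH /= /andP[es us]].
  by rewrite /= !expr0 mul1r; apply: ler_sum => G _; rewrite mul1r.
have {us}IH := IH us; rewrite exprS -mulrA.
pose V G := x ^+ count (fun f => f \in edges G) s * W G.
have V0 G : 0 <= V G by rewrite mulr_ge0// exprn_ge0//; lra.
have x0 : 0 <= x by lra.
have hV G : e \in edges G -> V G <= r * V (del_edge e G).
  move=> eG; rewrite /V [leRHS]mulrCA.
  have -> : count (fun f => f \in edges (del_edge e G)) s = count (fun f => f \in edges G) s.
    apply: eq_in_count => f fs; rewrite edges_del_edge !inE.
    by case: eqP fs es => // -> ->.
  by rewrite ler_wpM2l ?exprn_ge0// hW.
have S10 := sum_with_edge_le V0 hV r0.
have m0 : 0 <= (1 + x * r) / (1 + r) by rewrite divr_ge0 ?(ltW r1)// addr_ge0// mulr_ge0.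
apply: (le_trans _ (ler_wpM2l m0 IH)).
have -> : \sum_G x ^+ ((e \in edges G) + count (fun f => f \in edges G) s) * W G =
   x * \sum_(G | e \in edges G) V G + \sum_(G | e \notin edges G) V G.
  rewrite (bigID (fun G => e \in edges G))/= mulr_sumr; congr (_ + _).
    by apply: eq_bigr => G ->; rewrite add1n exprS mulrA.
  by apply: eq_bigr => G /negPf ->.
have -> : \sum_G x ^+ count (fun f => f \in edges G) s * W G =
   \sum_(G | e \in edges G) V G + \sum_(G | e \notin edges G) V G.
  by rewrite (bigID (fun G => e \in edges G)).
move: S10; set S1 := \sum_(G | _) _; set S0 := \sum_(G | _) _ => S10.
rewrite mulrAC ler_pdivlMr//.
(* [x S1 + S0] is at most [(1 + x r) / (1 + r)] times [S1 + S0] precisely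
   when [(x - 1) S1 <= (x - 1) r S0]. *)
have : (x - 1) * S1 <= (x - 1) * (r * S0) by rewrite ler_wpM2l//; lra.
lra.
Qed.

(** Deleting an edge can only destroy triangles, which are penalized. *)
Lemma weight_del_edge_le (a b : R) G e : (0 < n)%N -> b <= 0 -> e \in edges G ->
  gibbs_weight a b G <= expR (2 * a) * gibbs_weight a b (del_edge e G).
Proof.
move=> n0 b0 eG; rewrite !weightE// -expRD ler_expR.
have -> : #|edges G|%:R = #|edges (del_edge e G)|%:R + 1 :> R.
  by rewrite (cardsD1 e) eG edges_del_edge natrD addrC.
have T : #|triangles (del_edge e G)|%:R <= #|triangles G|%:R :> R.
  rewrite ler_nat; apply: subset_leq_card; apply/fintype.subsetP => A.
  rewrite !inE => /andP[-> /forallP h]; apply/forallP => f; apply/implyP.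
  by move=> /(implyP (h f)); rewrite edges_del_edge !inE => /andP[].
have : 6 * b / n%:R * #|triangles G|%:R <= 6 * b / n%:R * #|triangles (del_edge e G)|%:R.
  by rewrite ler_wnM2l// mulr_le0_ge0 ?invr_ge0//; lra.
lra.
Qed.

Lemma sum_weight_tilt_le (a b x : R) : (0 < n)%N -> b <= 0 -> 1 <= x ->
  \sum_(G : simple_graph n) x ^+ #|edges G| * gibbs_weight a b G <=
  ((1 + x * expR (2 * a)) / (1 + expR (2 * a))) ^+ 'C(n, 2) *
    \sum_(G : simple_graph n) gibbs_weight a b G.
Proof.
move=> n0 b0 x1.
pose s := enum [pred e : {set 'I_n} | #|e| == 2%N].
have <- : size s = 'C(n, 2).
  rewrite -cardE -[n in RHS]card_ord -card_draws.
  by apply: eq_card => e; rewrite !inE.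
apply: le_trans (sum_tilt_count_le (enum_uniq _) x1 (expR_ge0 _) _ _).
- apply: ler_sum => G _; rewrite ler_wpM2r ?expR_ge0//.
  rewrite le_eqVlt; apply/orP; left; apply/eqP; congr (_ ^+ _).
  rewrite -size_filter cardE; apply: perm_size; apply: uniq_perm.
  + exact: enum_uniq.
  + by rewrite filter_uniq// enum_uniq.
  + move=> e; rewrite [RHS]mem_filter /s !mem_enum inE.
    by case: (boolP (e \in edges G)) => // /edge_card2 ->.
- by move=> G; exact: expR_ge0.
- by move=> G e; exact: weight_del_edge_le.
Qed.
End edge_deletion.

Section repulsive.
Local Open Scope classical_set_scope.
Local Open Scope ring_scope.
Variable R : realType.

(** The logarithm of the left-hand side is minus the entropy of [logistic a]
    relative to [logistic (2 a)]. *)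
Lemma chernoff_rate_lt1 (a : R) : a < 0 ->
  (1 + expR (- a) * expR (2 * a)) / (1 + expR (2 * a)) * expR (a * c1 a) < 1.
Proof.
move=> a0.
have u01 := logistic_itv a; have v01 := logistic_itv (2 * a).
have uv : logistic a != logistic (2 * a).
  by rewrite gt_eqF//; apply: logistic_homo; lra.
have u01' : 0 <= logistic a <= 1 by case/andP: u01 => u0 u1; rewrite !ltW.
have := entropy_lt_cross u01' v01 uv.
have lnc t : ln (1 - logistic t) = - ln (1 + expR t) :> R.
  by rewrite logistic_compl lnV// posrE; have := expR_gt0 t; lra.
rewrite /entropy !ln_logistic !lnc => h.
have e1 := expR_gt0 a; have e2 := expR_gt0 (2 * a).
have p1 : 0 < 1 + expR a by lra.
have p2 : 0 < 1 + expR (2 * a) by lra.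
rewrite -expRD (_ : - a + 2 * a = a); last by ring.
have -> : (1 + expR a) / (1 + expR (2 * a)) * expR (a * c1 a) =
    expR (ln (1 + expR a) - ln (1 + expR (2 * a)) + a * c1 a).
  by rewrite !(expRD, expRN) !lnK ?posrE.
rewrite expR_lt1 /c1 -/(logistic a); lra.
Qed.

(** Chernoff's bound with [x = exp (- a)], which tilts the edge probability
    [logistic (2 a)] to [logistic a = c1]. *)
Lemma ergm_prob_repulsive_cvg0 (a b : R) : a < 0 -> b <= 0 ->
  (fun n => ergm_prob a b (fun G : simple_graph n => c1 a < edge_density R G)) @ \oo --> (0 : R).
Proof.
move=> a0 b0; have := chernoff_rate_lt1 a0; set m := _ / _; set r := m * _ => r1.
have m0 : 0 < m by rewrite divr_gt0// ltr_pwDl// ?mulr_ge0 ?expR_ge0.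
have r0 : 0 < r by rewrite mulr_gt0// expR_gt0.
apply: (@cvg0_le_geometric _ _ r^-1 r); first by rewrite ltW.
move=> n n0; rewrite ergm_prob_weight//.
set Z := \sum_(G : simple_graph n) gibbs_weight a b G.
have Z0 : 0 < Z.
  have G0 : simple_graph n.
    by exists finset.set0; apply/forall_inP => e; rewrite finset.in_set0.
  by rewrite /Z (bigD1 G0)//= ltr_pwDl ?expR_gt0// sumr_ge0// => H _; exact: expR_ge0.
apply/andP; split.
  by rewrite divr_ge0 ?(ltW Z0)// sumr_ge0// => G _; exact: expR_ge0.
rewrite ler_pdivrMr//.
have x1 : 1 <= expR (- a) by rewrite -expR0 ler_expR; lra.
apply: (@le_trans _ _ (r ^+ 'C(n, 2) * Z)); last first.
  rewrite ler_pM2r// -[leRHS]mulrC -ler_pdivrMr ?invr_gt0// invrK -exprSr.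
  rewrite ler_wiXn2l ?(ltW r0) ?(ltW r1)//.
  case: n n0 {Z Z0} => // k _; rewrite ltnS binS bin1; lia.
rewrite /r exprMn mulrAC -/m.
apply: (@le_trans _ _ (expR (a * c1 a) ^+ 'C(n, 2) *
    \sum_(G : simple_graph n) expR (- a) ^+ #|edges G| * gibbs_weight a b G)); last first.
  by rewrite mulrC ler_wpM2r ?exprn_ge0 ?expR_ge0// sum_weight_tilt_le.
rewrite mulr_sumr big_mkcond; apply: ler_sum => G _; case: ifP => [AG|_]; last first.
  by rewrite !mulr_ge0 ?exprn_ge0 ?expR_ge0.
rewrite mulrA ler_peMl ?expR_ge0// -!expRM_natr -expRD -[leLHS]expR0 ler_expR.
have : a * #|edges G|%:R <= a * (c1 a * 'C(n, 2)%:R) by rewrite ler_nM2l// edge_density_gt.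
lra.
Qed.
End repulsive.

(** * The phase transition *)

Local Open Scope classical_set_scope.
Local Open Scope ring_scope.

Theorem theorem5p1 (R : realType) (beta1 : R) (hbeta1 : beta1 < 0)
    (hc : c1 beta1 < c2 beta1) :
  exists q : R, 0 <= q /\
    (forall beta2 : R, beta2 < q ->
       (fun n : nat =>
          ergm_prob beta1 beta2 (fun G : simple_graph n => c1 beta1 < edge_density R G))
         @ \oo --> (0 : R)) /\
    (forall beta2 : R, q < beta2 ->
       (fun n : nat =>
          ergm_prob beta1 beta2 (fun G : simple_graph n => edge_density R G < c2 beta1))
         @ \oo --> (0 : R)).
Proof.
have [q [q0 below above]] := threshold_exists hbeta1 hc.
exists q; split => //; split => beta2.
  move=> bq; have [b0|b0] := leP 0 beta2; last first.
    by apply: ergm_prob_repulsive_cvg0 => //; exact: ltW.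
  have [|eta eta0 sep] := below beta2; first by rewrite b0.
  apply: (ergm_prob_tilted_cvg0 b0 sep) => n G fG.
  by rewrite ler_pM2l//; exact: edge_density_gt.
move=> qb; have [eta eta0 sep] := above _ qb.
have b0 : 0 <= beta2 by apply: ltW; exact: le_lt_trans qb.
apply: (ergm_prob_tilted_cvg0 b0 sep) => n G fG.
by rewrite !mulNr lerN2 ler_pM2l//; exact: edge_density_lt.
Qed.
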